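(* Let $G$ be a graph with convex balls and let $\Gamma$ be a group acting geometrically on $G$. Then $\Gamma$ is biautomatic.
   Context: Graphs are simple, undirected and connected; $G$ has convex balls if each ball $B_r(v)$ contains every vertex on a shortest path between two of its vertices. A group $\Gamma$ acts geometrically on $G$ if it acts by graph automorphisms properly (stabilizers of vertices and edges are finite) and cocompactly (finitely many orbits of vertices and edges). A group $\Gamma$ is biautomatic if there exist a finite generating set $S$ and a regular language $\mathcal L$ over $S\cup S^{-1}$ (accepted by a finite state automaton) such that every element of $\Gamma$ is represented by a word of $\mathcal L$ and the corresponding paths in the Cayley graph $\mathrm{Cay}(\Gamma,S)$ satisfy the $2$-sided fellow traveler property: there are constants $C>0,D\ge0$ such that for any two such paths $\gamma_1,\gamma_2$ (parametrized by arc length and extended constantly after their endpoints) and all $i$, $d(\gamma_1(i),\gamma_2(i))\le C\max\{d(\gamma_1(0),\gamma_2(0)),d(\gamma_1(\infty),\gamma_2(\infty))\}+D$. *)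

(* Defs.v *)
From HB Require Import structures.
From mathcomp Require Import all_boot.
From mathcomp Require Import boolp classical_sets cardinality.

Set Implicit Arguments.
Unset Strict Implicit.
Unset Printing Implicit Defensive.

Local Open Scope classical_set_scope.

(** * Graphs *)

(* Simple undirected graphs, possibly infinite. *)
Record graph := Graph {
  vertex :> choiceType;
  adj : rel vertex;
  adj_sym : symmetric adj;
  adj_irr : irreflexive adj
}.

Section Graph.
Variable G : graph.
Implicit Types u v : G.

(* The vertex sequence of the walk is [u :: p]; its length is [size p]. *)
Definition is_walk u v (p : seq G) : bool := path (@adj G) u p && (last u p == v).

(* The empty graph does not count as connected: every group acts on it with
   no orbits at all. *)
Definition connected_graph : Prop :=
  inhabited G /\ forall u v, exists p, is_walk u v p.

(* The value 0 for vertices in different components is junk. *)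
Definition gdist u v : nat :=
  if pselect (exists n, `[< exists2 p, is_walk u v p & size p = n >]) is left h
  then ex_minn h else 0.

Definition gball (v : G) (r : nat) : set G := [set u | gdist v u <= r].

Definition shortest_path u v (p : seq G) : bool :=
  is_walk u v p && (size p == gdist u v).

Definition geodesically_convex (A : set G) : Prop :=
  forall u v p x, A u -> A v -> shortest_path u v p -> x \in u :: p -> A x.

Definition convex_balls : Prop :=
  forall (v : G) (r : nat), geodesically_convex (gball v r).

(* Edges as unordered pairs. *)
Definition edges : set (set G) :=
  [set E | exists u v, adj u v /\ E = [set u; v]].

End Graph.

(** * Geometric actions *)

Record graph_action (gT : groupType) (G : graph) := GraphAction {
  act :> gT -> G -> G;
  act1 : forall v, act 1%g v = v;
  actM : forall g h v, act (g * h)%g v = act g (act h v);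
  act_adj : forall g u v, adj (act g u) (act g v) = adj u v
}.

Section Action.
Variables (gT : groupType) (G : graph) (a : graph_action gT G).

Definition act_edge (g : gT) (E : set G) : set G := a g @` E.

Definition stabilizer (X : Type) (f : gT -> X -> X) (x : X) : set gT :=
  [set g | f g x = x].

Definition orbits (X : Type) (f : gT -> X -> X) (A : set X) : set (set X) :=
  [set [set f g x | g in setT] | x in A].

(* The stabilizer of an edge is setwise: inversions are allowed. *)
Definition proper_action : Prop :=
  (forall v, finite_set (stabilizer a v)) /\
  (forall E, edges E -> finite_set (stabilizer act_edge E)).

Definition cocompact_action : Prop :=
  finite_set (orbits a setT) /\ finite_set (orbits act_edge (@edges G)).

Definition geometric_action : Prop := proper_action /\ cocompact_action.

End Action.

(** * Regular languages *)

Record dfa (A : Type) := DFA {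
  dfa_state : finType;
  dfa_init : dfa_state;
  dfa_final : {pred dfa_state};
  dfa_trans : dfa_state -> A -> dfa_state
}.

Definition dfa_accept (A : Type) (M : dfa A) (w : seq A) : bool :=
  foldl (@dfa_trans A M) (dfa_init M) w \in @dfa_final A M.

(* [L] is a regular language over the finite alphabet listed by [Sigma]; the
   transitions of [M] on other elements of [A] are irrelevant. *)
Definition regular_language (A : eqType) (Sigma : seq A) (L : set (seq A)) :
    Prop :=
  exists M : dfa A,
    forall w, L w <-> all [in Sigma] w /\ dfa_accept M w.

(** * Biautomatic groups *)

Section Biautomatic.
Variable gT : groupType.
Implicit Types (S : seq gT) (w : seq gT) (L : set (seq gT)).

Definition letters S : seq gT := S ++ [seq s^-1%g | s <- S].

Definition word_val w : gT := (\prod_(s <- w) s)%g.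

Definition generates S : Prop :=
  forall g, exists w, all [in letters S] w /\ word_val w = g.

Definition cayley_adj S : rel gT :=
  fun x y => (x != y) && ((x^-1 * y)%g \in letters S).

Lemma cayley_adj_sym S : symmetric (cayley_adj S).
Proof.
have sub x y : cayley_adj S x y -> cayley_adj S y x.
  rewrite /cayley_adj eq_sym => /andP[-> /=].
  have -> : (y^-1 * x = (x^-1 * y)^-1)%g by rewrite invgM invgK.
  rewrite !mem_cat => /orP[h|/mapP[s sS ->]]; last by rewrite invgK sS.
  by rewrite map_f ?orbT.
by move=> x y; apply/idP/idP; apply: sub.
Qed.

Lemma cayley_adj_irr S : irreflexive (cayley_adj S).
Proof. by move=> x; rewrite /cayley_adj eqxx. Qed.

Definition Cay S : graph :=
  Graph (@cayley_adj_sym S) (@cayley_adj_irr S).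

(* The path in [Cay S] that starts at [g] and is labelled by [w], after [i]
   steps; it is constant for [i >= size w]. *)
Definition word_path (g : gT) w (i : nat) : gT := (g * word_val (take i w))%g.

(* The two-sided property compares paths with arbitrary, possibly distinct,
   starting points.  Distances being natural numbers, taking [C] and [D] in
   [nat] loses no generality. *)
Definition fellow_traveler2 S L : Prop :=
  exists C D : nat, 0 < C /\
    forall (g1 g2 : gT) w1 w2, L w1 -> L w2 -> forall i,
      @gdist (Cay S) (word_path g1 w1 i) (word_path g2 w2 i) <=
        C * maxn (@gdist (Cay S) g1 g2)
                 (@gdist (Cay S) (word_path g1 w1 (size w1))
                                 (word_path g2 w2 (size w2))) + D.

Definition biautomatic : Prop :=
  exists S L,
    [/\ generates S,
        regular_language (letters S) L,
        forall g, exists2 w, L w & word_val w = g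
      & fellow_traveler2 S L].

End Biautomatic.

(* Main.v *)
Require Import Defs.
From mathcomp Require Import all_boot.
From mathcomp Require Import zify boolp classical_sets cardinality.

(* Write B_m(v) for balls.  Convexity of balls gives that the neighbours of u
   closer to v are pairwise adjacent, that two adjacent vertices equidistant
   from v have a common neighbour closer to v or form the base of a pentagon
   with apex closer to v, and a rigidity statement ([no_double_side],
   [strip_thin]): if v ~ w, p ~ q, d(p, v) = d(p, w) = d(q, v) = m and d(q, w) = m - 1, then
   every geodesic from p to v is uniformly close to every geodesic from q to w.

   The combing is coarse.  Starting from X_k = {x} with k = d(v, x), let
   X_j = [thread v x j] be the set of vertices of B_j(v) at distance at most 2
   from all vertices of X_{j+1}.  The assignment X_{j+1} |-> X_j reverses
   inclusions, so the relation "one set contains the other" propagates down to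
   v: threads with the same v and adjacent x stay close.  They do not die out
   because each t with d(v, t) = m >= 2 has a w with d(v, w) = m - 2 such that
   B_2(t) /\ B_{m-1}(v) is contained in B_2(w) ([grandparent]).  For v ~ w, the
   threads towards v and w coincide until they meet a vertex equidistant from
   v and w; there a strip as above starts, and rigidity takes over.

   An automaton reading a geodesic outwards from v guesses the sets X_j and
   stores, up to translation, X_j and the trace of B_j(v) on a ball of radius 7
   around the current vertex; this trace determines the next one
   ([parent_stays_close]). *)

Set Implicit Arguments.
Unset Strict Implicit.
Unset Printing Implicit Defensive.

Local Open Scope classical_set_scope.

(** * Distances in graphs with convex balls *)

(** The geometry uses only these properties of the graph distance. The equation in [dist_conv] puts
    [z] on a shortest path from [x] to [y]. *)
Record cb_metric (V : Type) (d : V -> V -> nat) : Prop := CbMetric {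
  dist_eq0 : forall x y, d x y = 0 -> x = y;
  dist_refl : forall x, d x x = 0;
  dist_sym : forall x y, d x y = d y x;
  dist_tri : forall x y z, d x z <= d x y + d y z;
  dist_geo : forall x y, 0 < d x y -> exists z, d x z = 1 /\ (d z y).+1 = d x y;
  dist_conv : forall v r x y z, d v x <= r -> d v y <= r ->
    d x z + d z y = d x y -> d v z <= r
}.

Ltac tri x y z :=
  match goal with
  | cb : cb_metric _ |- _ =>
    pose proof (dist_tri cb x y z); pose proof (dist_tri cb y z x);
    pose proof (dist_tri cb z x y)
  end.

Ltac has_sym d a b :=
  lazymatch goal with
  | _ : d a b = d b a |- _ => idtac
  | _ : d b a = d a b |- _ => idtac
  end.

Ltac syms :=
  match goal with
  | cb : cb_metric ?d |- _ =>
    repeat match goal with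
    | H : context [d ?a ?b] |- _ =>
        assert_fails (idtac; has_sym d a b); pose proof (dist_sym cb a b)
    | |- context [d ?a ?b] =>
        assert_fails (idtac; has_sym d a b); pose proof (dist_sym cb a b)
    end
  end.

Ltac dlia := first [assumption | syms; lia].

(** * Neighbours and shortest paths relative to a base vertex *)

Section Geometry.
Variables (V : Type) (d : V -> V -> nat) (cb : cb_metric d).

(** Otherwise [u] is the midpoint of a shortest path from [a] to [b], and convexity puts it in the
    ball of radius [d v u - 1] around [v]. *)
Lemma nbr_clique v u a b : d u a = 1 -> d u b = 1 ->
  d v a < d v u -> d v b < d v u -> d a b <= 1.
Proof.
move=> ua ub va vb; rewrite leqNgt; apply/negP => ab.
have := @dist_conv _ _ cb v (d v u).-1 a b u; tri a u b; dlia.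
Qed.

Lemma parent v x : 0 < d v x -> exists a, d x a = 1 /\ (d v a).+1 = d v x.
Proof.
move=> h; have [|a [xa av]] := @dist_geo _ _ cb x v; first dlia.
by exists a; split=> //; dlia.
Qed.

Lemma between x y i : i <= d x y -> exists z, d x z = i /\ d z y = d x y - i.
Proof.
elim: i => [|i IH] h; first by exists x; rewrite (dist_refl cb) subn0.
have [|z [xz zy]] := IH; first dlia.
have [|w [zw wy]] := @dist_geo _ _ cb z y; first dlia.
by exists w; tri x z w; tri x w y; split; dlia.
Qed.

(** Otherwise [t] lies on a shortest path from [t'] to [y], against convexity of a ball around
    [v]. *)
Lemma pull v t t' y : d t t' = 1 -> d v t' < d v t -> d v y < d v t ->
  d t' y <= d t y.
Proof.
move=> tt vt vy; rewrite leqNgt; apply/negP => h.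
have := @dist_conv _ _ cb v (d v t).-1 t' y t; tri t' t y; dlia.
Qed.

(** * The triangle-pentagon condition *)

Definition pentagonal v t s := forall c, d v c < d v t -> d t c = 1 -> d s c = 1 -> False.

Lemma pentagonal_sym v t s : d v t = d v s -> pentagonal v t s -> pentagonal v s t.
Proof. by move=> e b c; rewrite -e => h sc tc; apply: (b c). Qed.

(** Distance 3 would put [t] on a shortest path from [a] to [b], against convexity of a ball around
    [v]. Distance 1 would make [a] and [s] neighbours of [b] closer to [t], hence adjacent. *)
Lemma pentagonal_dist v t s a b : d t s = 1 -> d v t = d v s -> pentagonal v t s ->
  d t a = 1 -> d s b = 1 -> d v a < d v t -> d v b < d v t -> d a b = 2.
Proof.
move=> ts e bd ta sb va vb.
have sa : d s a <> 1 by move=> h; apply: (bd a).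
have tb : d t b <> 1 by move=> h; apply: (bd b).
tri t s b; tri s t a; tri v t b; tri v s a; tri a t b.
have tb2 : d t b = 2 by have := @dist_eq0 _ _ cb t b;
    case E : (d t b) => [|] h; [have := h erefl => ?; subst; dlia|dlia].
have sa2 : d s a = 2 by have := @dist_eq0 _ _ cb s a;
    case E : (d s a) => [|] h; [have := h erefl => ?; subst; dlia|dlia].
case: (leqP 2 (d a b)) => h; last first.
  have [ab0|ab1] : d a b = 0 \/ d a b = 1 by dlia.
    by have e2 := dist_eq0 cb ab0; subst; dlia.
  have := @nbr_clique t b a s; dlia.
have := @dist_conv _ _ cb v (d v t).-1 a b t; dlia.
Qed.

Lemma eq_or_adj x y : d x y <= 1 -> x = y \/ d x y = 1.
Proof. by case E : (d x y) => [|[|n]] // _; [left; apply: dist_eq0 E|right]. Qed.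

(** The triangle-pentagon condition at distance [k + 1], in the strong form where one lower corner
    [a] of the pentagon is prescribed. *)
Definition tpc k := forall v x y a, d x y = 1 -> d v x = k.+1 -> d v y = k.+1 ->
  d x a = 1 -> d v a = k ->
  (exists c, [/\ d x c = 1, d y c = 1 & d v c = k]) \/
  (exists b e, [/\ d y b = 1, d v b = k, d a e = 1, d b e = 1 & (d v e).+1 = k]).

(* The disjunction breaks a circularity: levels up to 2 need nothing, and give
   the triangle-pentagon condition at radius 3, which suffices for all levels
   and hence yields the condition at all radii. *)
Lemma pentagonal_dominates_of_tpc k v t s y t' : (k <= 2 \/ tpc 2) ->
  d v t = k -> d v s = k -> d v y = k -> d t s = 1 -> d s y = 1 -> pentagonal v t s ->
  d t t' = 1 -> d v t' < k -> d t' y <= 2.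
Proof.
move=> hk vt vs vy ts sy bd tt' vt'; case: (leqP (d t' y) 2) => // h3.
have t's : d s t' <> 1 by move=> h; apply: (bd t'); dlia.
tri t' s y; tri t s t'; tri v s t'; tri t' t y; tri t s y.
have t's2 : d t' s = 2.
  have [|] := ltnP 0 (d t' s); first dlia.
  by rewrite leqn0 => /eqP/(dist_eq0 cb) ?; subst; dlia.
have t'y : d t' y = 3 by dlia.
have ty : d t y = 2 by dlia.
(* If [f] existed, the midpoint of [t'] and [f] would be a common neighbour of [t] and [s] closer to
   [v]. *)
have case1 f : d y f = 1 -> d s f = 1 -> d v f < k -> False.
  move=> yf sf vf.
  have t'f : d t' f = 2 by apply: (@pentagonal_dist v t s); dlia.
  have [|c [t'c cf]] := @between t' f 1; first dlia.
  have vc : d v c < k.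
    by have := @dist_conv _ _ cb v k.-1 t' f c; dlia.
  tri c f y; tri t' c y.
  have /eq_or_adj [tc|tc] : d t c <= 1 by apply: (@nbr_clique y t'); dlia.
    by subst; dlia.
  have tf : d t f <> 1 by move=> h; apply: (bd f); dlia.
  have := @nbr_clique t f c s; tri t c f; tri v t f.
  have [tf0|tf0] := posnP (d t f); first by have ? := dist_eq0 cb tf0; subst; dlia.
  move=> h; have /eq_or_adj [cs|cs] : d c s <= 1 by apply: h; dlia.
    by subst; dlia.
  by apply: (bd c); dlia.
have [|f [yf vf]] := @parent v y; first by rewrite vy; dlia.
have t'f : d t' f <= 3 by have := @pull v y f t'; dlia.
case: (ltnP (d t' f) 3) => t'f3.
  have /eq_or_adj [fs|fs] : d f s <= 1 by apply: (@nbr_clique t' y); dlia.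
    by subst; dlia.
  by have := case1 f; dlia.
case: hk => [k2|tpc2]; first by tri v t' f; dlia.
(* Seen from [t'], the edge [y f] lies at distance 3. A triangle on it contradicts [case1]; a
   pentagon yields a common neighbour [e] of [t] and [s]. *)
have := @tpc2 t' y f s; case; [dlia|dlia|dlia|dlia|dlia| |].
- move=> [g [yg fg t'g]].
  have vg : d v g <= k.-1 by apply: (@dist_conv _ _ cb v k.-1 t' f); dlia.
  have /eq_or_adj [gs|gs] : d g s <= 1 by apply: (@nbr_clique t' y); dlia.
    by subst; dlia.
  by have := case1 g; dlia.
- move=> [b [e [fb t'b se be t'e]]].
  tri e b f; tri t' e f; tri e s y; tri t' e y.
  have ve : d v e <= k.-1 by apply: (@dist_conv _ _ cb v k.-1 t' f); dlia.
  have /eq_or_adj [et|et] : d e t <= 1 by apply: (@nbr_clique y t'); dlia.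
    by subst; dlia.
  by have := bd e; dlia.
Qed.

(** If all parents of [a] were at distance 3 from [y], they would also be at distance at least 3
    from a parent [b] of [y]. Then the midpoint [c] of [a] and [b] is level with both, [a c] is
    pentagonal, and domination brings [b] within 2 of a parent of [a]. *)
Lemma tpc_of_pentagonal_dominates k :
  (forall v t s y t', d v t = k -> d v s = k -> d v y = k -> d t s = 1 -> d s y = 1 ->
    pentagonal v t s -> d t t' = 1 -> d v t' < k -> d t' y <= 2) ->
  tpc k.
Proof.
move=> bdom v x y a xy vx vy xa va.
case: (pselect (exists c, [/\ d x c = 1, d y c = 1 & d v c = k])) => [|no]; first by left.
have bd : pentagonal v x y.
  move=> c vc xc yc; apply: no; exists c; split=> //; tri v x c; dlia.
right.
have [k0|k0] := posnP k.
  have ? : v = a by apply: dist_eq0 cb _ _ _; dlia.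
  by subst; case: no; exists a; split=> //; dlia.
suff [s [as_ vs ys]] : exists s, [/\ d a s = 1, (d v s).+1 = k & d y s <= 2].
  tri v s y.
  have [|b [yb bs]] := @between y s 1; first dlia.
  by exists b, s; tri v b s; tri v y b; split=> //; dlia.
case: (pselect (exists s, [/\ d a s = 1, (d v s).+1 = k & d y s <= 2])) => // nos.
have y3 s : d a s = 1 -> (d v s).+1 = k -> d y s = 3 /\ d x s = 2.
  move=> as_ vs; tri x a s; tri y x s; tri v x s.
  case: (leqP (d y s) 2) => h; last by split; dlia.
  by case: nos; exists s.
have [|b [yb vb]] := @parent v y; first dlia.
have ab : d a b = 2 by apply: (@pentagonal_dist v x y); dlia.
have b3 s : d a s = 1 -> (d v s).+1 = k -> 3 <= d b s.
  move=> as_ vs; have [ys xs] := y3 s as_ vs; tri b y s.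
  rewrite ltnNge; apply/negP => bs.
  have /eq_or_adj [e|e] : d x b <= 1 by apply: (@nbr_clique s y); dlia.
    by subst; dlia.
  by apply: (bd b); dlia.
have [|s [as_ vs]] := @parent v a; first dlia.
have [|c [ac cb_]] := @between a b 1; first dlia.
have vc : d v c <= k by apply: (@dist_conv _ _ cb v k a b); dlia.
have vc' : d v c = k.
  tri v a c; case: (ltnP (d v c) k) => h; last dlia.
  by have := b3 c; tri b c c; dlia.
exfalso; have := b3 s as_ ltac:(dlia); suff : d s b <= 2 by dlia.
apply: (@bdom v a c b s); try dlia.
move=> s' vs' as' cs'; have := b3 s' as'; tri b c s'; tri v a s'; dlia.
Qed.

Lemma tpc2 : tpc 2.
Proof.
apply: tpc_of_pentagonal_dominates => v t s y t' *.
by apply: (@pentagonal_dominates_of_tpc 2 v t s); auto.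
Qed.

Lemma pentagonal_dominates k v t s y t' : d v t = k -> d v s = k -> d v y = k ->
  d t s = 1 -> d s y = 1 -> pentagonal v t s -> d t t' = 1 -> d v t' < k -> d t' y <= 2.
Proof. by apply: pentagonal_dominates_of_tpc; right; apply: tpc2. Qed.

Lemma triangle_pentagon k : tpc k.
Proof. by apply: tpc_of_pentagonal_dominates => v t s y t'; apply: pentagonal_dominates. Qed.

(** * Rigidity of strips *)

Lemma no_rectangle v w a b n : 1 < n -> d a b = 1 -> d v w = 1 ->
  (d v a).+1 = n -> (d w b).+1 = n -> d w a = n -> d v b = n -> False.
Proof.
move=> n1 ab vw va wb wa vb.
have [|c [bc wc]] := @parent w b; first dlia.
have : d a c <= 1 by apply: (@nbr_clique v b); tri v w c; dlia.
by tri a c w; dlia.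
Qed.

(** Both [v] and the vertex before [w] on the shortest path are neighbours of [w] closer to [a], so
    they are equal or adjacent. *)
Lemma geodesic_end v w a z n : d v w = 1 -> (d v a).+1 = n -> d w a = n ->
  d a z + d z w = n -> 0 < d z w -> d z v <= d z w.
Proof.
move=> vw va wa azw zw.
have [|y [zy yw]] := @between z w (d z w).-1; first dlia.
have : d v y <= 1 by apply: (@nbr_clique a w); tri a z y; dlia.
by tri z y v; dlia.
Qed.

(** Triangles or pentagons give a shortest path from [a] to [w] or from [b] to [v]; by
    [geodesic_end] one of its vertices is too close to the other end of [v w]. In the longest case
    this vertex is at distance [n - 3] from [w] and must differ from [w], whence [3 < n]. *)
Lemma no_double_side v w u a b n : 3 < n -> d v w = 1 -> d v u = n -> d w u = n ->
  d u a = 1 -> (d v a).+1 = n -> d w a = n ->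
  d u b = 1 -> (d w b).+1 = n -> d v b = n -> False.
Proof.
move=> n4 vw vu wu ua va wa ub wb vb.
have [[c [uc bc vc]]|[f [e [bf vf ae fe ve]]]] :=
    @triangle_pentagon n.-1 v u b a ub ltac:(dlia) ltac:(dlia) ua ltac:(dlia).
- have cw : d c w <= d c v by apply: (@geodesic_end w v b c n); dlia.
  have wc : d w c = n.-1 by tri w u c; dlia.
  have /eq_or_adj [ac|ac] : d a c <= 1 by apply: (@nbr_clique v u); dlia.
    by subst; dlia.
  have [|r [cr wr]] := @parent w c; first dlia.
  have [[g [cg bg wg]]|[g [e [bg wg re ge we]]]] :=
      @triangle_pentagon n.-2 w c b r ltac:(dlia) ltac:(dlia) ltac:(dlia) cr ltac:(dlia).
  + tri a c g; tri a g w; tri v g b.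
    have := @geodesic_end v w a g n; dlia.
  + tri a c r; tri a r e; tri a e w; tri v e g; tri v g b.
    have := @geodesic_end v w a e n; dlia.
- tri b f e; tri b e v; tri a e w.
  have := @geodesic_end w v b e n; dlia.
Qed.

Definition strip v w p q m :=
  [/\ d p q = 1, d v p = m, d w p = m, d v q = m & (d w q).+1 = m].

Lemma strip_step v w p q m p' q' : 3 < m -> d v w = 1 -> strip v w p q m ->
  d p p' = 1 -> (d v p').+1 = m -> d q q' = 1 -> (d w q').+2 = m ->
  strip v w p' q' m.-1.
Proof.
move=> m4 vw [pq vp wp vq wq] pp' vp' qq' wq'.
have wp' : d w p' = m.-1.
  tri w p p'; tri p' v w; case: (ltnP (d w p') m) => h; first dlia.
  by case: (@no_double_side v w p p' q m); dlia.
have vq' : d v q' = m.-1 by tri v q q'; tri v w q'; dlia.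
have /eq_or_adj [e|qp'] : d q p' <= 1 by apply: (@nbr_clique w p); dlia.
  by subst; dlia.
have /eq_or_adj [e|pq'] : d p' q' <= 1 by apply: (@nbr_clique v q); dlia.
  by subst; dlia.
by split; dlia.
Qed.

(** Iterates [strip_step], which needs [3 < m], so the descent stops at level 3. *)
Lemma strip_thin v w p q m l x y : d v w = 1 -> strip v w p q m -> 2 < l <= m ->
  d v x = l -> d p x = m - l -> (d w y).+1 = l -> d q y = m - l ->
  d x y = 1.
Proof.
move=> vw; elim: m p q => [|m IH] p q pqs lm vx px wy qy; first dlia.
have [pq vp wp vq wq] := pqs.
have [e|lm'] := eqVneq l m.+1.
  have ? : p = x by apply: dist_eq0 cb _ _ _; dlia.
  have ? : q = y by apply: dist_eq0 cb _ _ _; dlia.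
  by subst.
have [|p' [pp' p'x]] := @dist_geo _ _ cb p x; first dlia.
have [|q' [qq' q'y]] := @dist_geo _ _ cb q y; first dlia.
tri v p' x; tri v p p'; tri w q' y; tri w q q'.
apply: (IH p' q'); try dlia.
by apply: (strip_step _ vw pqs); dlia.
Qed.

(** If a parent [u'] of [u] fails, it is at distance [R + 1] from [y], and its neighbour on the way
    to [y] is another parent of [u]. The bound on [R] allows [no_double_side] at distance
    [R + 1]. *)
Lemma parent_stays_close v u z y R : 2 < R -> d v u = d v z -> d u z <= R ->
  d z y = 1 -> d v y < d v z -> exists u', [/\ d u u' = 1, (d v u').+1 = d v u & d u' y <= R].
Proof.
move=> R3 uz duz zy vy.
have [|u' [uu' vu']] := @parent v u; first dlia.
case: (leqP (d u' y) R) => h; first by exists u'.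
tri u u' y; tri u z y; tri z u u'.
have := @pull v u u' y uu' ltac:(dlia) ltac:(dlia).
have := @pull v z y u' zy ltac:(dlia) ltac:(dlia) => zu' uy.
have [|a [u'a ay]] := @dist_geo _ _ cb u' y; first dlia.
exists a.
(* Otherwise [no_double_side] applies to the edge [y z] seen from [u']. *)
have va : d v a <= d v u' by apply: (@dist_conv _ _ cb v (d v u') u' y); tri v y z; dlia.
have za : d z a = R.
  tri z u' a; tri z y a; case: (ltnP R (d z a)) => hza; last dlia.
  by case: (@no_double_side y z u' a u R.+1); dlia.
have /eq_or_adj [e|e] : d a u <= 1 by apply: (@nbr_clique z u'); dlia.
  by subst; dlia.
by tri v u a; split; dlia.
Qed.

End Geometry.

(** * Threads *)

Section Trajectories.
Variables (V : eqType) (d : V -> V -> nat) (cb : cb_metric d).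
Hypothesis locfin : forall t, exists s : seq V, forall a, d t a = 1 -> a \in s.

Lemma grandparent v t : 1 < d v t ->
  exists w, [/\ d t w = 2, (d v w).+2 = d v t &
    forall y, d v y < d v t -> d t y <= 2 -> d w y <= 2].
Proof.
move=> vt; have [s ins] := locfin t.
pose A a := (d t a == 1) && (d v a < d v t).
pose cnt w := count (fun a => A a && (d w a == 1)) s.
pose D w := d t w = 2 /\ (d v w).+2 = d v t.
(* [w] has as many neighbours as possible among the parents of [t]; a parent of
   [t] that it misses then spans a pentagonal edge with each parent it hits. *)
have [w [[tw vw] maxw]] : exists w, D w /\ forall w', D w' -> cnt w' <= cnt w.
  have ex : exists n, `[< exists w, D w /\ cnt w = n >].
    have [|a [ta va]] := @parent _ _ cb v t; first dlia.
    have [|w [aw vw]] := @parent _ _ cb v a; first dlia.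
    exists (cnt w); apply/asboolP; exists w; split=> //.
    by tri t a w; tri v t w; split; dlia.
  have ub n : `[< exists w, D w /\ cnt w = n >] -> n <= size s.
    by move=> /asboolP [w [_ <-]]; apply: count_size.
  case: (ex_maxnP ex ub) => n /asboolP [w [Dw cw]] mx.
  exists w; split=> // w' Dw'; rewrite cw; apply: mx.
  by apply/asboolP; exists w'.
have adjA a b : A a -> A b -> d a b <= 1.
  by move=> /andP [/eqP ta va] /andP [/eqP tb vb]; apply: (@nbr_clique _ _ cb v t).
have badA a a1 : A a -> A a1 -> d w a1 = 1 -> d w a <> 1 -> pentagonal d v a a1.
  move=> Aa Aa1 wa1 wa c vc ac a1c.
  have Aa' := Aa; have Aa1' := Aa1.
  move: Aa' Aa1' => /andP [/eqP ta va] /andP [/eqP ta1 va1].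
  have Dc : D c by tri t a c; tri v t c; tri v a c; split; dlia.
  have /(eq_or_adj cb) [?|wc] : d w c <= 1.
    by apply: (@nbr_clique _ _ cb v a1); tri v t a1; case: Dc; dlia.
    by subst c; dlia.
  (* The vertex [c] is adjacent to [a] and to every parent that [w] hits, against the choice of
     [w]. *)
  have ca : forall b, A b -> d w b = 1 -> d c b = 1.
    move=> b Ab wb; have /andP [/eqP tb vb] := Ab.
    have cb2 : d c b <= 2 by tri c w b; dlia.
    have [cb0|cb1] := eqVneq (d c b) 0.
      have ? := dist_eq0 cb cb0; subst b; tri v t c; case: Dc; dlia.
    have [//|cb3] := eqVneq (d c b) 1.
    have /(eq_or_adj cb) [?|ab] := adjA _ _ Aa Ab; first by subst b.
    have /(eq_or_adj cb) [?|e] : d w a <= 1 by apply: (@nbr_clique _ _ cb b c); dlia.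
      by subst a; tri v t w; case: Dc; dlia.
    by [].
  have := maxw _ Dc; rewrite leqNgt => /negP; apply.
  rewrite /cnt -(cat_take_drop (index a s) s) !count_cat.
  have ais : a \in s by apply: ins.
  have lt : index a s < size s by rewrite index_mem.
  rewrite (drop_nth a lt) nth_index //= Aa /=.
  have -> : (d c a == 1) = true by apply/eqP; dlia.
  have -> : (d w a == 1) = false by apply/eqP.
  have sub r : count (fun b => A b && (d w b == 1)) r <= count (fun b => A b && (d c b == 1)) r.
    by apply: sub_count => b /andP [Ab /eqP wb]; rewrite Ab (ca b Ab wb).
  by have := sub (take (index a s) s); have := sub (drop (index a s).+1 s); lia.
have [|a1 [ta1 a1w]] := @between _ _ cb t w 1; first dlia.
have Aa1 : A a1.
  by rewrite /A ta1 eqxx /=; tri v a1 w; dlia.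
have wa1 : d w a1 = 1 by dlia.
have va1 : (d v a1).+1 = d v t by tri v a1 w; tri v t a1; move: Aa1 => /andP [_ ?]; dlia.
(* If [w] misses [a], the edge [a a1] is pentagonal: [pentagonal_dist] handles [y] below [a],
   [pentagonal_dominates] handles [y] level with [a]. *)
have viaA a y : A a -> d a y = 1 -> d v y < d v t -> d w y <= 2.
  move=> Aa ay vy; have /andP [/eqP ta va] := Aa.
  have [wa|/eqP wa] := eqVneq (d w a) 1; first by tri w a y; dlia.
  have bda := badA a a1 Aa Aa1 wa1 wa.
  have va' : (d v a).+1 = d v t by tri v t a; dlia.
  have /(eq_or_adj cb) [?|aa1] := adjA _ _ Aa Aa1; first by subst a.
  have bda' : pentagonal d v a1 a by apply: pentagonal_sym bda; dlia.
  case: (ltnP (d v y) (d v a)) => vya.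
    by rewrite (@pentagonal_dist _ _ cb v a1 a w y) //; dlia.
  by apply: (@pentagonal_dominates _ _ cb (d v a) v a1 a y w); dlia.
exists w; split=> // y vy ty.
have [ty0|ty0] := posnP (d t y).
  by have ? := dist_eq0 cb ty0; subst y; dlia.
case: (ltnP 1 (d t y)) => ty1; last first.
  have Ay : A y by rewrite /A vy andbT; apply/eqP; dlia.
  by have := adjA _ _ Ay Aa1; tri w a1 y; dlia.
have [|s0 [ts sy]] := @between _ _ cb t y 1; first dlia.
case: (ltnP (d v s0) (d v t)) => vs.
  by apply: (viaA s0); rewrite ?/A ?ts ?eqxx //; dlia.
have vs' : d v s0 = d v t by tri v s0 y; dlia.
have vy' : (d v y).+1 = d v t by tri v s0 y; dlia.
case: (pselect (exists a, [/\ d t a = 1, d s0 a = 1 & d v a < d v t])) => [[a [ta sa va]]|nog].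
  have Aa : A a by rewrite /A ta eqxx.
  have /(eq_or_adj cb) [?|ay] : d a y <= 1 by apply: (@nbr_clique _ _ cb v s0); dlia.
    by subst a; have := adjA _ _ Aa Aa1; tri w a1 y; dlia.
  exact: (viaA a).
have bd : pentagonal d v t s0 by move=> c *; apply: nog; exists c.
have bd' : pentagonal d v s0 t by apply: pentagonal_sym bd; dlia.
have [[c [sc tc vc]]|[a [e [ta va ye ae ve]]]] :=
    @triangle_pentagon _ _ cb (d v t).-1 v s0 t y ltac:(dlia) ltac:(dlia) ltac:(dlia) ltac:(dlia) ltac:(dlia).
  by case: (bd c); dlia.
have Aa : A a by rewrite /A ta eqxx /=; dlia.
have [wa|/eqP wa] := eqVneq (d w a) 1.
  have : d e w <= 1 by apply: (@nbr_clique _ _ cb v a); dlia.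
  by tri w e y; dlia.
have bda := badA a a1 Aa Aa1 wa1 wa.
have /(eq_or_adj cb) [?|aa1] := adjA _ _ Aa Aa1; first by subst a.
have we : d w e = 2.
  rewrite (dist_sym cb).
  by apply: (@pentagonal_dist _ _ cb v a a1); dlia.
case: (leqP (d w y) 2) => // wy3.
have wy : d w y = 3 by tri w e y; dlia.
have a1y : d a1 y = 2 by apply: (@pentagonal_dist _ _ cb v t s0); dlia.
(* The midpoint [z] of [w] and [e] would be adjacent to [a1], and then [pentagonal_dist] for [a a1]
   puts it at distance 2 from [e]. *)
have [|z [wz ze]] := @between _ _ cb w e 1; first dlia.
have vz : d v z <= d v w by apply: (@dist_conv _ _ cb v (d v w) w e z); dlia.
have /(eq_or_adj cb) [?|a1z] : d a1 z <= 1 by apply: (@nbr_clique _ _ cb y w); tri z e y; dlia.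
  by subst z; case: (bda e); dlia.
have : d e z = 2 by apply: (@pentagonal_dist _ _ cb v a a1); dlia.
by dlia.
Qed.

(** * Threads and their points *)

Definition step v m (X : set V) : set V :=
  [set y | d v y <= m /\ forall t, X t -> d t y <= 2].

(** The value [X] for [l >= m] keeps threads constant past their end. *)
Fixpoint traj v m (X : set V) l : set V :=
  if m is m'.+1 then if l <= m' then traj v m' (step v m' X) l else X else X.

Definition comparable (X Y : set V) := X `<=` Y \/ Y `<=` X.

Lemma step_anti v m X Y : X `<=` Y -> step v m Y `<=` step v m X.
Proof. by move=> XY y [vy h]; split=> // t Xt; apply: h; apply: XY. Qed.

Lemma traj_comparable v m X Y l :
  comparable X Y -> comparable (traj v m X l) (traj v m Y l).
Proof.
elim: m X Y => [//|m IH] X Y XY /=; case: ifP => // _; apply: IH.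
by case: XY => XY; [right|left]; apply: step_anti.
Qed.

Lemma traj_top v m X l : m <= l -> traj v m X l = X.
Proof. by case: m => [//|m] /= lm; rewrite leqNgt lm. Qed.

Lemma traj_comp v m X j l : l <= j <= m ->
  traj v m X l = traj v j (traj v m X j) l.
Proof.
elim: m X => [|m IH] X /andP [lj jm].
  by rewrite (eqP (_ : j == 0)) //= -leqn0.
have [->|jm'] := eqVneq j m.+1; first by rewrite (@traj_top v m.+1 X m.+1).
have lm : l <= m by lia.
have jm1 : j <= m by lia.
by rewrite /= lm jm1; apply: IH; rewrite lj.
Qed.

Lemma traj_step v m X l : l < m -> traj v m X l = step v l (traj v m X l.+1).
Proof.
elim: m X => [//|m IH] X lm /=.
have -> : l <= m by lia.
have [->|lm'] := eqVneq l m; first by rewrite traj_top // ltnn.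
by rewrite (_ : l < m) ?IH //; lia.
Qed.

(** The set one level below [t] lies within 2 of [t], so the vertex of [grandparent] belongs to the
    set two levels below. This descends by two, which is why only even offsets are covered. *)
Lemma traj_geodesic v m X t : X t -> d v t = m ->
  exists z : nat -> V, z m = t /\ forall j, j <= m ->
    [/\ d v (z j) = j, j < m -> d (z j) (z j.+1) = 1
      & ~~ odd (m - j) -> traj v m X j (z j)].
Proof.
elim/ltn_ind: m X t => m IH X t Xt vt.
case: m IH vt => [|[|m]] IH vt.
- exists (fun=> t); split=> // j; rewrite leqn0 => /eqP ->; split=> //.
- have [|a [ta va]] := @parent _ _ cb v t; first dlia.
  exists (fun j => if j == 1 then t else a); split=> // -[|[|j]] //= _; split=> //; dlia.
have [|w [tw vw dom]] := @grandparent v t; first dlia.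
have [|a [ta aw]] := @between _ _ cb t w 1; first dlia.
have Yw : traj v m.+2 X m w.
  rewrite traj_step // traj_step // (@traj_top _ m.+2) //; split; first dlia.
  by move=> s [vs hs]; have := dom s; have := hs t Xt; dlia.
have [z [zm hz]] := IH m ltac:(lia) _ w Yw ltac:(dlia).
exists (fun j => if j == m.+2 then t else if j == m.+1 then a else z j).
split; first by rewrite eqxx.
move=> j jm; have [->|j2] := eqVneq j m.+2.
  by split; [dlia|lia|rewrite traj_top].
have [->|j1] := eqVneq j m.+1.
  rewrite eqxx; split; first (tri v t a; tri v a w; dlia); first dlia.
  by rewrite (_ : m.+2 - m.+1 = 1) //; lia.
have [vz zz oz] := hz j ltac:(lia); split=> //.
  move=> _; rewrite !eqSS (negPf j1); have [->|jm0] := eqVneq j m.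
    by rewrite zm; dlia.
  by apply: zz; lia.
move=> odd2; rewrite (@traj_comp _ _ _ m); last lia.
by apply: oz; move: odd2; rewrite (_ : m.+2 - j = (m - j).+2) /= ?negbK //; lia.
Qed.

Definition thread v x l := traj v (d v x) [set x] l.

Lemma thread_top v x l : d v x <= l -> thread v x l = [set x].
Proof. exact: traj_top. Qed.

Lemma thread_step v x l : l < d v x -> thread v x l = step v l (thread v x l.+1).
Proof. exact: traj_step. Qed.

Lemma geodesic_dist v t m l (z : nat -> V) : z m = t ->
  (forall j, j <= m -> d v (z j) = j /\ (j < m -> d (z j) (z j.+1) = 1)) ->
  l <= m -> d t (z l) = m - l.
Proof.
move=> zm hz lm.
have up : forall i, i <= m -> d t (z (m - i)) <= i.
  elim=> [|i IH] im; first by rewrite subn0 zm (dist_refl cb).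
  have [_] := hz (m - i.+1) ltac:(lia); rewrite (_ : (m - i.+1).+1 = m - i); last lia.
  by have := IH ltac:(lia); tri t (z (m - i)) (z (m - i.+1)); dlia.
have := up (m - l) ltac:(lia); rewrite subKn //.
have [vt _] := hz m (leqnn m); have [vz _] := hz l lm.
by rewrite zm in vt; tri v t (z l); dlia.
Qed.

Lemma thread_point v x l : l <= d v x ->
  exists t, [/\ thread v x l t, d v t = l & d x t = d v x - l].
Proof.
(* For odd [d v x - l] the descent by two starts at a parent [a] of [x], which lies on the
   thread. *)
move=> lx; case E : (odd (d v x - l)); last first.
  have [z [zx hz]] := @traj_geodesic v (d v x) [set x] x erefl erefl.
  have [vz _ ez] := hz l lx; exists (z l); split=> //.
    by apply: ez; rewrite E.
  by apply: (@geodesic_dist v x (d v x)) zx _ lx => j /hz [].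
have [|a [xa va]] := @parent _ _ cb v x; first by case: (d v x) E; lia.
have Ta : thread v x (d v x).-1 a.
  rewrite thread_step ?prednK ?thread_top //; try lia.
  by split; [dlia|move=> _ ->; dlia].
have [z [za hz]] := @traj_geodesic v (d v x).-1 _ a Ta ltac:(lia).
have lx' : l <= (d v x).-1 by case: (d v x) E lx => [|n] //=; case: (eqVneq l n.+1) => [->|]; rewrite ?subnn //; lia.
have [vz _ ez] := hz l lx'.
have az : d a (z l) = (d v x).-1 - l.
  by apply: (@geodesic_dist v a (d v x).-1) za _ lx' => j /hz [].
exists (z l); split=> //; last by tri x a (z l); tri v x (z l); dlia.
rewrite /thread (@traj_comp _ _ _ (d v x).-1); last lia.
apply: ez; move: E; rewrite -(prednK (_ : 0 < d v x)) /= ?subSn //=; lia.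
Qed.

Lemma thread_nonempty v x l : exists t, thread v x l t.
Proof.
case: (leqP l (d v x)) => h; first by have [t []] := thread_point h; exists t.
by exists x; rewrite thread_top // ltnW.
Qed.

Lemma thread_level v x l y : l <= d v x -> thread v x l y -> d v y <= l.
Proof.
move=> lx; have [->|lx'] := eqVneq l (d v x); first by rewrite thread_top // => ->.
by rewrite thread_step; [case|lia].
Qed.

Lemma thread_diam v x l y y' : thread v x l y -> thread v x l y' -> d y y' <= 4.
Proof.
case: (leqP (d v x) l) => h; first by rewrite thread_top // => -> ->; rewrite (dist_refl cb).
have [t Tt] := thread_nonempty v x l.+1.
by rewrite thread_step // => -[_ /(_ t Tt) ?] [_ /(_ t Tt) ?]; tri y t y'; dlia.
Qed.

Lemma thread_succ v x l y y' : thread v x l y -> thread v x l.+1 y' -> d y y' <= 2.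
Proof.
case: (leqP (d v x) l) => h.
  by rewrite !thread_top //; [move=> -> ->; rewrite (dist_refl cb)|lia].
by rewrite thread_step // => -[_ hy] /hy; dlia.
Qed.

(** * Threads with a common base vertex *)

(** The singleton of [t] is contained in the set at level [j]. Comparability persists downwards, and
    sets of threads have diameter at most 4. *)
Lemma thread_sub v x t j l y y' : thread v x j t -> d v t = j -> j <= d v x -> l <= j ->
  thread v t l y -> thread v x l y' -> d y y' <= 4.
Proof.
move=> Tt vt jx lj yT yT'.
have : comparable (thread v t l) (thread v x l).
  rewrite /thread (@traj_comp v (d v x) _ j l) ?lj // vt.
  by apply: traj_comparable; left=> _ ->.
case=> sub; first exact: thread_diam (sub _ yT) yT'.
exact: thread_diam yT (sub _ yT').
Qed.

(** If the distances to [v] differ, the closer of [x] and [x'] lies on the thread of the other.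
    Otherwise a parent of [x] lies on both threads, and each comparison with its thread costs 4. *)
Lemma thread_adj v x x' l y y' : d x x' = 1 ->
  thread v x l y -> thread v x' l y' -> d y y' <= 8.
Proof.
wlog le : x x' y y' / d v x' <= d v x.
  move=> hw xx Ty Ty'; case: (leqP (d v x') (d v x)) => h; first exact: hw xx Ty Ty'.
  by rewrite (dist_sym cb); apply: (hw x' x) => //; dlia.
move=> xx Ty Ty'; case: (leqP (d v x) l) => lx.
  move: Ty Ty'; rewrite !thread_top //; [|lia].
  by move=> -> ->; rewrite xx.
have near a : d x a <= 2 -> (d v a).+1 = d v x -> thread v x (d v x).-1 a.
  move=> xa va; rewrite thread_step; last lia.
  by split; [lia|rewrite prednK ?thread_top; [move=> _ ->|lia|lia]].
have [e|ne] := eqVneq (d v x) (d v x'); last first.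
  have Tx' : thread v x (d v x).-1 x' by apply: near; tri v x x'; dlia.
  have e' : d v x' = (d v x).-1 by tri v x x'; dlia.
  by have := @thread_sub v x x' (d v x).-1 l y' y Tx' e' ltac:(lia) ltac:(lia) Ty' Ty; dlia.
have [|a [xa va]] := @parent _ _ cb v x; first lia.
have Ta : thread v x (d v x).-1 a by apply: near; dlia.
have Ta' : thread v x' (d v x').-1 a.
  rewrite thread_step; last lia.
  split; first lia; rewrite prednK ?thread_top; [move=> _ ->|lia|lia].
  by tri x' x a; dlia.
have [u Tu] := thread_nonempty v a l.
have := @thread_sub v x a (d v x).-1 l u y Ta ltac:(lia) ltac:(lia) ltac:(lia) Tu Ty.
have := @thread_sub v x' a (d v x').-1 l u y' Ta' ltac:(lia) ltac:(lia) ltac:(lia) Tu Ty'.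
by tri y u y'; dlia.
Qed.

Lemma thread_fellow_end v x x' l y y' :
  thread v x l y -> thread v x' l y' -> d y y' <= 8 * d x x' + 4.
Proof.
move En : (d x x') => n; elim: n x x' y y' En => [|n IH] x x' y y' En Ty Ty'.
  have ? := dist_eq0 cb En; subst x'; exact: thread_diam Ty Ty'.
have [|x1 [xx1 x1x']] := @dist_geo _ _ cb x x'; first lia.
have [u Tu] := thread_nonempty v x1 l.
have := thread_adj xx1 Ty Tu; have := IH x1 x' u y' ltac:(lia) Tu Ty'.
by tri y u y'; dlia.
Qed.

(** * Threads towards adjacent base vertices *)

(** A strip starts where [w] stops being closer than [v]: at [y z] itself or, if [y] is below [z],
    one level down. An immediate change to [v] being closer is excluded by [no_rectangle]. *)
Lemma strip_near v w z y : d v w = 1 -> d z y <= 1 -> d v z = (d w z).+1 ->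
  d v y <= d w y -> 1 < d v z ->
  exists p q m, [/\ strip d v w p q m, d z p <= 1 & d z q <= 1].
Proof.
move=> vw /(eq_or_adj cb) [<-|zy] vz vy vz1; first lia.
tri v z y; tri w z y; tri v w y.
have [[e1 e2]|[[e1 e2]|[e1 e2]]] : (d v y = d v z /\ d w y = d v z) \/
  (((d v y).+1 = d v z /\ d w y = d v z) \/ ((d v y).+1 = d v z /\ (d w y).+1 = d v z)) by dlia.
- by exists y, z, (d v z); rewrite (dist_refl cb); split=> //; [split; dlia|dlia].
- by case: (@no_rectangle _ _ cb v w y z (d v z)); dlia.
- have [|q [zq wq]] := @parent _ _ cb w z; first lia.
  tri v z q; tri v w q.
  have /(eq_or_adj cb) [?|yq] : d y q <= 1 by apply: (@nbr_clique _ _ cb v z); dlia.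
    by subst q; lia.
  by exists y, q, (d v y); split; [split; dlia|dlia|dlia].
Qed.

Lemma strip_fellow v w p q m l y y' : d v w = 1 -> strip d v w p q m ->
  thread v p l.+1 y -> thread w q l y' -> d y y' <= 12.
Proof.
move=> vw s Ty Ty'; have [pq vp wp vq wq] := s.
case: (leqP l.+1 m) => lm; last first.
  move: Ty Ty'; rewrite !thread_top; try lia.
  by move=> -> ->; lia.
have [|u [Tu vu pu]] := @thread_point v p l.+1; first lia.
have [|u' [Tu' wu' qu']] := @thread_point w q l; first lia.
have := thread_diam Ty Tu; have := thread_diam Ty' Tu'.
have : d u u' <= 4.
  case: (leqP l 1) => l1; first by tri u v u'; tri v w u'; dlia.
  by rewrite (@strip_thin _ _ cb v w p q m l.+1 u u'); dlia.
by tri y u y'; tri u u' y'; dlia.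
Qed.

Lemma thread_fellow_closer v w x l y y' : d v w = 1 -> d v x = (d w x).+1 ->
  thread v x l.+1 y -> thread w x l y' -> d y y' <= 60.
Proof.
move=> vw vx Ty Ty'.
(* [div l]: above level [l] the two threads share a vertex near a strip. *)
pose div l := exists i t, [/\ l < i < d v x, thread v x i.+1 t, thread w x i t,
  d v t = i.+1 & d w t = i /\ (i <= 2 \/
  exists p q m, [/\ strip d v w p q m, d t p <= 2 & d t q <= 2])].
have dich e : e < d v x -> thread v x (d v x - e) = thread w x (d v x - e).-1 \/
    div (d v x - e).-1.
  elim: e => [|e IH] ek; first by left; rewrite !thread_top //; lia.
  have {IH} [IH|[i [t [ii ? ? ? ?]]]] := IH ltac:(lia); last first.
    by right; exists i, t; split=> //; lia.
  pose j := (d v x - e.+1).-1.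
  have e1 : d v x - e = j.+2 by rewrite /j; lia.
  have e2 : d v x - e.+1 = j.+1 by rewrite /j; lia.
  have jx : j.+1 < d v x by lia.
  rewrite e1 /= in IH; rewrite e2 /=.
  (* If the next set stays within [j] of [w], the threads still coincide. Otherwise it has a vertex
     [u] no closer to [w] than to [v], and for [j > 1] a strip starts near the path from [t] to
     [u]. *)
  case: (pselect (forall u, thread v x j.+1 u -> d w u <= j)) => [h|h].
    left; apply/seteqP; split=> u.
      move=> Tu; rewrite thread_step; last lia.
      split; first exact: h.
      by move: Tu; rewrite thread_step // IH => -[].
    rewrite (@thread_step w); last lia.
    move=> [wu hu]; rewrite thread_step // IH; split=> //.
    by tri v w u; dlia.
  right; have [u [Tu wu]] : exists u, thread v x j.+1 u /\ j < d w u.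
    apply: contrapT => h2; apply: h => u Tu; rewrite leqNgt; apply/negP => wu.
    by apply: h2; exists u.
  have [|t [Tt wt xt]] := @thread_point w x j.+1; first lia.
  have vt : d v t = j.+2 by tri v x t; tri v w t; dlia.
  have vu : d v u <= j.+1 by apply: thread_level Tu; lia.
  exists j.+1, t; split=> //; first by lia.
    by rewrite IH.
  split=> //.
  case: (leqP j 1) => j1; [by left; lia|right].
  have tu : d t u <= 2.
    by move: Tu; rewrite thread_step // => -[_]; apply; rewrite IH.
  have [s [ts su]] : exists s, d t s <= 1 /\ d s u <= 1.
    case: (leqP (d t u) 1) => tu1; first by exists t; rewrite (dist_refl cb).
    by have [|s [ts su]] := @between _ _ cb t u 1; [lia|exists s; lia].
  case: (leqP (d v s) (d w s)) => hs.
    have [|||p [q [m [st tp tq]]]] := @strip_near v w t s vw ts; try dlia.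
    by exists p, q, m; split=> //; lia.
  have vs : d v s = (d w s).+1 by tri v w s; dlia.
  have [|||p [q [m [st sp sq]]]] := @strip_near v w s u vw su; try dlia.
    by tri v t s; dlia.
  by exists p, q, m; split=> //; tri t s p; tri t s q; dlia.
case: (leqP (d v x) l.+1) => lx.
  move: Ty Ty'; rewrite !thread_top; try lia.
  by move=> -> ->; rewrite (dist_refl cb).
have := dich (d v x - l.+1) ltac:(lia); rewrite subKn ?(ltnW lx) //= => -[e|[i [t [li Tt Tt' vt [wt hi]]]]].
  by rewrite e in Ty; have := thread_diam Ty Ty'; lia.
have [u Tu] := thread_nonempty v t l.+1.
  have [u' Tu'] := thread_nonempty w t l.
  have uy := @thread_sub v x t i.+1 l.+1 u y Tt vt ltac:(lia) ltac:(lia) Tu Ty.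
  have uy' := @thread_sub w x t i l u' y' Tt' wt ltac:(lia) ltac:(lia) Tu' Ty'.
  case: hi => [i3|[p [q [m [st tp tq]]]]].
    have := @thread_level v x l.+1 y ltac:(lia) Ty.
    have := @thread_level w x l y' ltac:(lia) Ty'.
    by tri y v y'; tri v w y'; dlia.
  have [u1 Tu1] := thread_nonempty v p l.+1.
  have [u1' Tu1'] := thread_nonempty w q l.
  (* The total is 4 + 20 + 12 + 20 + 4: to the threads of [t], from there to those of [p] and [q],
     and across the strip. *)
  have := strip_fellow vw st Tu1 Tu1'.
  have := thread_fellow_end Tu Tu1; have := thread_fellow_end Tu' Tu1'.
  by tri y u y'; tri u u1 y'; tri u1 u1' y'; tri u1' u' y'; dlia.
Qed.

Lemma thread_fellow_unequal v w x l y y' : d v w = 1 -> d v x <> d w x ->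
  thread v x l y -> thread w x l y' -> d y y' <= 62.
Proof.
wlog vx : v w y y' / d v x = (d w x).+1.
  move=> hw vw ne Ty Ty'; tri v w x.
  have [e|e] : d v x = (d w x).+1 \/ d w x = (d v x).+1 by dlia.
    exact: (hw v w).
  by rewrite (dist_sym cb); apply: (hw w v) => //; dlia.
move=> vw _; case: l => [|l] Ty Ty'.
  have := @thread_level v x 0 y ltac:(lia) Ty; have := @thread_level w x 0 y' ltac:(lia) Ty'.
  by tri v w y'; tri y v y'; dlia.
have [u Tu] := thread_nonempty w x l.
have := thread_fellow_closer vw vx Ty Tu; have := thread_succ Tu Ty'.
by tri y u y'; dlia.
Qed.

(** If [v] and [w] are equidistant from [x], a triangle or pentagon joins them by at most four edges
    along which the distance to [x] changes; 248 is four times 62. *)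
Lemma thread_fellow_base_adj v w x l y y' : d v w = 1 ->
  thread v x l y -> thread w x l y' -> d y y' <= 248.
Proof.
move=> vw Ty Ty'.
have [e|/eqP ne] := eqVneq (d v x) (d w x); last first.
  by have := thread_fellow_unequal vw ne Ty Ty'; lia.
have [v0|v0] := posnP (d v x).
  have ? : v = x by apply: dist_eq0 cb _ _ _.
  have ? : w = x by apply: dist_eq0 cb _ _ _; lia.
  by subst; lia.
have [|a [va xa]] := @parent _ _ cb x v; first dlia.
have [[c [vc wc xc]]|[b [e' [wb xb ae be xe]]]] :=
    @triangle_pentagon _ _ cb (d v x).-1 x v w a ltac:(dlia) ltac:(dlia) ltac:(dlia) ltac:(dlia) ltac:(dlia).
  have [u Tu] := thread_nonempty c x l.
  have := @thread_fellow_unequal v c x l y u ltac:(dlia) ltac:(dlia) Ty Tu.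
  have := @thread_fellow_unequal w c x l y' u ltac:(dlia) ltac:(dlia) Ty' Tu.
  by tri y u y'; dlia.
have [u Tu] := thread_nonempty a x l.
have [u' Tu'] := thread_nonempty b x l.
have [z Tz] := thread_nonempty e' x l.
have := @thread_fellow_unequal v a x l y u ltac:(dlia) ltac:(dlia) Ty Tu.
have := @thread_fellow_unequal w b x l y' u' ltac:(dlia) ltac:(dlia) Ty' Tu'.
have := @thread_fellow_unequal a e' x l u z ltac:(dlia) ltac:(dlia) Tu Tz.
have := @thread_fellow_unequal b e' x l u' z ltac:(dlia) ltac:(dlia) Tu' Tz.
by tri y u y'; tri u z y'; tri z u' y'; dlia.
Qed.

Lemma thread_fellow v v' x x' l y y' : thread v x l y -> thread v' x' l y' ->
  d y y' <= 248 * (d v v' + d x x') + 8.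
Proof.
move En : (d v v') => n; elim: n v y En => [|n IH] v y En Ty Ty'.
  have ? := dist_eq0 cb En; subst v'.
  by have := thread_fellow_end Ty Ty'; lia.
have [|w [vw wv']] := @dist_geo _ _ cb v v'; first lia.
have [u Tu] := thread_nonempty w x l.
have := @thread_fellow_base_adj v w x l y u vw Ty Tu.
by have := IH w u ltac:(lia) Tu Ty'; tri y u y'; dlia.
Qed.

Lemma thread_isometry (f : V -> V) v x l y :
  (forall a b, d (f a) (f b) = d a b) -> (forall b, exists a, f a = b) ->
  thread v x l y <-> thread (f v) (f x) l (f y).
Proof.
move=> fd fs; rewrite /thread fd.
have : forall a, [set x] a <-> [set f x] (f a).
  move=> a; split=> [->//|e]; apply: dist_eq0 cb _ _ _.
  by rewrite -fd e (dist_refl cb).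
move: (d v x) [set x] [set f x] => m.
elim: m y => [|m IH] y X X' XX /=; first exact: XX.
case: ifP => _ //; apply: IH => a; rewrite /step /= fd.
split=> -[va h]; split=> // t Xt.
  by have [b fb] := fs t; rewrite -fb fd; apply: h; rewrite XX fb.
by rewrite -fd; apply: h; rewrite -XX.
Qed.

(* The points of a geodesic at even distance from its end lie on the thread,
   hence the remaining ones are close to it. *)
Lemma thread_along_geodesic v x : exists z : nat -> V, z (d v x) = x /\
  forall j, j <= d v x -> [/\ d v (z j) = j, j < d v x -> d (z j) (z j.+1) = 1
    & forall y, thread v x j y -> d (z j) y <= 4].
Proof.
have [z [zx hz]] := @traj_geodesic v (d v x) [set x] x erefl erefl.
exists z; split=> // j jx; have [vz zz ez] := hz j jx; split=> // y Ty.
case E : (odd (d v x - j)); last first.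
  by apply: thread_diam Ty; apply: ez; rewrite E.
have jx' : j < d v x by move: E; have [->|] := eqVneq j (d v x); rewrite ?subnn //; lia.
have [_ _ ez'] := hz j.+1 jx'.
have Tz : thread v x j.+1 (z j.+1).
  by apply: ez'; move: E; rewrite (_ : d v x - j = (d v x - j.+1).+1) //; lia.
by have := thread_succ Ty Tz; have := zz jx'; tri (z j) (z j.+1) y; dlia.
Qed.
End Trajectories.

(** * The graph metric and the action *)

Lemma gdist_le_walk (G : graph) (u v : G) p : is_walk u v p -> gdist u v <= size p.
Proof.
move=> w; rewrite /gdist; case: pselect => // h; case: ex_minnP => m _; apply.
by apply/asboolP; exists p.
Qed.

Lemma gdist_walk (G : graph) (u v : G) :
  (exists p, is_walk u v p) -> exists2 p, is_walk u v p & size p = gdist u v.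
Proof.
move=> [p w]; rewrite /gdist; case: pselect => [h|[]].
  by case: ex_minnP => m /asboolP [q wq sq] _; exists q.
by exists (size p); apply/asboolP; exists p.
Qed.

Lemma is_walk_cat (G : graph) (u v w : G) p q :
  is_walk u v p -> is_walk v w q -> is_walk u w (p ++ q).
Proof.
move=> /andP [pp /eqP lp] /andP [pq /eqP lq].
by rewrite /is_walk cat_path last_cat lp pp pq lq eqxx.
Qed.

Lemma is_walk_rev (G : graph) (u v : G) p :
  is_walk u v p -> exists2 q, is_walk v u q & size q = size p.
Proof.
move=> /andP [pp /eqP lp]; exists (rev (belast u p)); last by rewrite size_rev size_belast.
rewrite /is_walk -lp rev_path; apply/andP; split.
  by rewrite (eq_path (e' := @adj G)) // => x y; rewrite adj_sym.
by case: p {pp lp} => //= y p; rewrite rev_cons last_rcons.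
Qed.

(** * The graph distance *)

Section GraphMetric.
Variables (G : graph) (Gconn : connected_graph G).
Implicit Types u v w : G.

Lemma gdist_attained u v : exists2 p, is_walk u v p & size p = gdist u v.
Proof. by apply: gdist_walk; case: Gconn. Qed.

Lemma gdist0 u : gdist u u = 0.
Proof.
by apply/eqP; rewrite -leqn0; apply: (@gdist_le_walk G u u [::]); rewrite /is_walk /= eqxx.
Qed.

Lemma gdist_tri u v w : gdist u w <= gdist u v + gdist v w.
Proof.
have [p wp <-] := gdist_attained u v; have [q wq <-] := gdist_attained v w.
by rewrite -size_cat; apply: gdist_le_walk; apply: is_walk_cat wp wq.
Qed.

Lemma gdist_sym_le u v : gdist u v <= gdist v u.
Proof.
have [p /is_walk_rev [q wq <-] <-] := gdist_attained v u; exact: gdist_le_walk.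
Qed.

Lemma gdist_sym u v : gdist u v = gdist v u.
Proof. by apply/eqP; rewrite eqn_leq !gdist_sym_le. Qed.

Lemma gdist_eq0 u v : gdist u v = 0 -> u = v.
Proof.
by have [[|x p] /andP [_ /eqP] /= lp <-] := gdist_attained u v.
Qed.

Lemma gdist1 u v : gdist u v = 1 <-> adj u v.
Proof.
split=> [|uv].
  have [[|x [|y p]] w <-] // := gdist_attained u v.
  by move: w; rewrite /is_walk /= andbT => /andP [ux /eqP <-].
apply/eqP; rewrite eqn_leq; apply/andP; split.
  by apply: (@gdist_le_walk _ _ _ [:: v]); rewrite /is_walk /= uv eqxx.
by rewrite lt0n; apply/eqP => /gdist_eq0 e; rewrite e adj_irr in uv.
Qed.

Lemma gdist_step u v : 0 < gdist u v ->
  exists w, gdist u w = 1 /\ (gdist w v).+1 = gdist u v.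
Proof.
have [[|w p] wlk e] := gdist_attained u v; first by rewrite -e.
move: wlk => /andP [/= /andP [uw pp] lp] _; exists w.
have uw1 : gdist u w = 1 by apply/gdist1.
split=> //; have : gdist w v <= size p by apply: gdist_le_walk; rewrite /is_walk pp.
by move: e => /= e; have := gdist_tri u w v; lia.
Qed.

Lemma gdist_cb_metric : convex_balls G -> cb_metric (@gdist G).
Proof.
move=> cvx; split; [exact: gdist_eq0|exact: gdist0|exact: gdist_sym|exact: gdist_tri|exact: gdist_step|].
move=> v r x y z vx vy e.
have [p wp sp] := gdist_attained x z; have [q wq sq] := gdist_attained z y.
apply: (cvx v r x y (p ++ q)) => //.
  by rewrite /shortest_path (is_walk_cat wp wq) size_cat sp sq e eqxx.
by rewrite -cat_cons mem_cat; move/andP: wp => [_ /eqP <-]; rewrite mem_last.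
Qed.

End GraphMetric.

(** * Finiteness from the geometric action *)

Section Action.
Variables (gT : groupType) (G : graph) (a : graph_action gT G).
Hypothesis Gconn : connected_graph G.

Lemma actK g : cancel (a g) (a g^-1%g).
Proof. by move=> x; rewrite -actM mulVg act1. Qed.

Lemma actKV g : cancel (a g^-1%g) (a g).
Proof. by move=> x; rewrite -actM mulgV act1. Qed.

Lemma gdist_act_le g u v : gdist (a g u) (a g v) <= gdist u v.
Proof.
have [p /andP [pp /eqP lp] <-] := gdist_attained Gconn u v.
rewrite -(size_map (a g)); apply: gdist_le_walk.
rewrite /is_walk last_map lp eqxx andbT path_map.
by rewrite (eq_path (e' := @adj G)) // => x y /=; rewrite act_adj.
Qed.

Lemma gdist_act g u v : gdist (a g u) (a g v) = gdist u v.
Proof.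
apply/eqP; rewrite eqn_leq gdist_act_le /=.
by have := gdist_act_le g^-1%g (a g u) (a g v); rewrite !actK.
Qed.

Lemma orbit_representatives (X : Type) (f : gT -> X -> X) (A : set X) :
  (forall x, f 1%g x = x) -> finite_set (orbits f A) ->
  exists R : set X, [/\ finite_set R, R `<=` A & forall x, A x -> exists r g, R r /\ f g r = x].
Proof.
move=> f1 fin; case: (pselect (exists x, A x)) => [[x0 Ax0]|nA]; last first.
  by exists set0; split=> // x Ax; case: nA; exists x.
have /choice [c hc] : forall O : set X, exists r, orbits f A O -> A r /\ O = [set f g r | g in setT].
  move=> O; case: (pselect (orbits f A O)) => [[r Ar <-]|nO]; first by exists r.
  by exists x0.
exists (c @` orbits f A); split; first exact: finite_image.
  by move=> _ [O oO <-]; case: (hc O oO).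
move=> x Ax; pose O := [set f g x | g in setT].
have oO : orbits f A O by exists x.
have [_ eO] := hc O oO.
have : O x by exists 1%g.
rewrite eO => -[g _ e]; exists (c O), g; split=> //; by exists O.
Qed.

Hypothesis ageom : geometric_action a.

Lemma finite_transporter u v : finite_set [set g | a g u = v].
Proof.
case: (pselect (exists g0, a g0 u = v)) => [[g0 e0]|n]; last first.
  by rewrite (_ : [set _ | _] = set0) //; apply/seteqP; split=> g //= e; apply: n; exists g.
have [[/(_ u) st _] _] := ageom.
apply: sub_finite_set (finite_image (fun h => g0 * h)%g st) => g /= e.
exists (g0^-1 * g)%g; last by rewrite mulVKg.
by rewrite /stabilizer /= actM e -e0 actK.
Qed.

(** There are finitely many edge orbits, and each contains finitely many edges at [t] because
    transporters between vertices are finite. *)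
Lemma finite_neighbours (t : G) : finite_set [set u | adj t u].
Proof.
have [_ [_ fin]] := ageom.
have [|R [Rfin Redge Rrep]] := orbit_representatives _ fin.
  move=> E; rewrite /act_edge; apply/seteqP; split=> [x [y Ey <-]|x Ex]; first by rewrite act1.
  by exists x => //; rewrite act1.
pose F E := [set u | adj t u /\ exists g, act_edge a g E = [set t; u]].
apply: (@sub_finite_set _ _ (\bigcup_(E in R) F E)).
  move=> u /= tu; have [|E [g [RE gE]]] := Rrep [set t; u]; first by exists t, u.
  by exists E => //; split=> //; exists g.
apply: bigcup_finite => // E /Redge [p [q [pq ->]]].
apply: (@sub_finite_set _ _ ((fun g => a g q) @` [set g | a g p = t] `|`
                            (fun g => a g p) @` [set g | a g q = t])); last first.
  by rewrite finite_setU; split; apply: finite_image; exact: finite_transporter.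
move=> u [tu [g e]].
have mem x : act_edge a g [set p; q] x <-> x = a g p \/ x = a g q.
  split; first by move=> [y [->|->] <-]; [left|right].
  by case=> ->; [exists p|exists q] => //; [left|right].
have [tg ug] : act_edge a g [set p; q] t /\ act_edge a g [set p; q] u.
  by rewrite e; split; [left|right].
have nut : t <> u by move=> h; rewrite h adj_irr in tu.
move/mem: tg => [et|et]; move/mem: ug => [eu|eu]; rewrite ?et ?eu //.
- by case: nut; rewrite et eu.
- by left; exists g.
- by right; exists g.
- by case: nut; rewrite et eu.
Qed.

Lemma gdist_locally_finite (t : G) : exists s : seq G, forall u, gdist t u = 1 -> u \in s.
Proof.
have /finite_seqP [s es] := finite_neighbours t; exists s => u /(gdist1 Gconn) tu.
have : [set u | adj t u] u by [].
by rewrite es.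
Qed.

Lemma finite_gball (v : G) n : finite_set (gball v n).
Proof.
elim: n => [|n IH].
  apply: (@sub_finite_set _ _ [set v]) => // u; rewrite /gball /= leqn0 => /eqP.
  by move=> /(gdist_eq0 Gconn).
apply: (@sub_finite_set _ _ (\bigcup_(z in gball v n) ([set z] `|` [set u | adj z u]))).
  move=> u; rewrite /gball /= => vu.
  have [u0|u0] := posnP (gdist u v).
    exists v => /=; first by rewrite gdist0.
    by left; apply: (gdist_eq0 Gconn).
  have [z [uz zv]] := gdist_step Gconn u0.
  exists z => /=; first by rewrite gdist_sym //; rewrite gdist_sym // in vu; lia.
  by right; rewrite /= adj_sym; apply/(gdist1 Gconn).
apply: bigcup_finite => // z _; rewrite finite_setU; split=> //; exact: finite_neighbours.
Qed.

Lemma cobounded (v0 : G) : exists c, forall z, exists g, gdist (a g v0) z <= c.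
Proof.
have [_ [fin _]] := ageom.
have [|R [/finite_seqP [s ->] _ rep]] := orbit_representatives _ fin; first exact: act1.
(* The sum bounds every distance from [v0] to an orbit representative. *)
exists (\sum_(r <- s) gdist v0 r) => z; have [r [g [/= rs <-]]] := rep z I.
by exists g; rewrite gdist_act (big_rem r) //= leq_addr.
Qed.

Lemma finite_displacement (v0 : G) n :
  exists S : seq gT, forall g, (g \in S) = (gdist v0 (a g v0) <= n).
Proof.
have : finite_set [set g | gdist v0 (a g v0) <= n].
  apply: (@sub_finite_set _ _ (\bigcup_(y in gball v0 n) [set g | a g v0 = y])).
    by move=> g gn; exists (a g v0).
  by apply: bigcup_finite; [exact: finite_gball|move=> y _; exact: finite_transporter].
move=> /finite_seqP [S eS]; exists S => g; apply/idP/idP => h.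
  by have : [set` S] g by []; rewrite -eS.
by have : [set g | gdist v0 (a g v0) <= n] g by []; rewrite eS.
Qed.

End Action.

(** The states are the elements of [Q]. A transition picks any word with the given value, which is
    harmless by the congruence; values not attained get a default. *)
Lemma regular_of_congruence (A : eqType) (Sigma : seq A) (Q : finType) (f : seq A -> Q)
    (F : pred Q) :
  (forall w w' s, f w = f w' -> f (rcons w s) = f (rcons w' s)) ->
  regular_language Sigma [set w | all [in Sigma] w /\ F (f w)].
Proof.
move=> cong.
pose tr q s := if pselect (exists w, f w = q) is left h then f (rcons (projT1 (cid h)) s) else q.
exists (DFA (f [::]) F tr) => w.
suff -> : dfa_accept (DFA (f [::]) F tr) w = F (f w) by [].
rewrite /dfa_accept /= -[RHS]/(f w \in F); congr (_ \in F).
elim/last_ind: w => [//|w s IH]; rewrite foldl_rcons IH /tr.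
case: pselect => [h|[]]; last by exists w.
by apply: cong; case: (cid h).
Qed.

(** * The automaton *)

Lemma word_val_rcons (gT : groupType) (w : seq gT) s :
  word_val (rcons w s) = (word_val w * s)%g.
Proof. by rewrite /word_val -cats1 big_cat big_seq1. Qed.

(** A vertex strictly closer to [v] than [z] serves as its own [x1] by [pull]; a vertex level with
    [z] has a suitable parent by [parent_stays_close]. *)
Lemma ball_extension (V : Type) (d : V -> V -> nat) (cb : cb_metric d) R v z1 z x :
  2 < R -> d z1 z = 1 -> d v z = (d v z1).+1 -> d z x <= R -> d v x <= d v z ->
  exists x1, [/\ d x1 x <= 1, d v x1 <= d v z1 & d z1 x1 <= R].
Proof.
move=> R3 z1z vz zx vx.
have zz1 : d z z1 = 1 by rewrite (dist_sym cb).
case: (ltnP (d v x) (d v z)) => vx'.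
  exists x; rewrite (dist_refl cb); split=> //; first lia.
  by have := @pull _ _ cb v z z1 x zz1 ltac:(lia) vx'; lia.
have [||||u [xu vu ux]] := @parent_stays_close _ _ cb v x z z1 R R3; try lia.
  by rewrite (dist_sym cb).
by exists u; rewrite !(dist_sym cb u) (dist_sym cb z1) in ux *; split; lia.
Qed.

Section Biautomatic.
Variables (G : graph) (gT : groupType) (a : graph_action gT G).
Hypotheses (Gconn : connected_graph G) (Gcb : convex_balls G)
  (ageom : geometric_action a).
Variables (v0 : G) (c0 : nat) (S : seq gT).
Hypothesis cob : forall z, exists g, gdist (a g v0) z <= c0.
Hypothesis memS : forall g, (g \in S) = (gdist v0 (a g v0) <= c0.*2.+1).

Let cb := gdist_cb_metric Gconn Gcb.
Let locfin := gdist_locally_finite Gconn ageom.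
Let gd := gdist_act a Gconn.
Let thread := thread (@gdist G).

(** * Comparison with the Cayley graph *)

Lemma gdist_mul g h x y : gdist (a (g^-1 * h)%g x) y = gdist (a h x) (a g y).
Proof. by rewrite actM -(gd g) actKV. Qed.

Lemma mem_letters g : (g \in letters S) = (gdist v0 (a g v0) <= c0.*2.+1).
Proof.
rewrite mem_cat memS; case E : (_ <= _) => //=; apply/negP => /mapP [s].
rewrite memS => h e; move: E; rewrite e -(gd s) actKV (gdist_sym Gconn).
by rewrite h.
Qed.

Lemma cayley_edge x y : gdist (a x v0) (a y v0) <= c0.*2.+1 ->
  exists2 p, @is_walk (Cay S) x y p & size p <= 1.
Proof.
move=> h; have [->|ne] := eqVneq x y; first by exists [::]; rewrite // /is_walk /= eqxx.
exists [:: y] => //; rewrite /is_walk /= eqxx !andbT /cayley_adj ne mem_letters.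
by rewrite (gdist_sym Gconn) gdist_mul (gdist_sym Gconn).
Qed.

(** Orbit points within [c0] of a shortest path shadow it; consecutive ones are at most
    [c0 + 1 + c0] apart, so they differ by letters. *)
Lemma cayley_walk n z h h' : gdist (a h v0) z <= c0 -> gdist z (a h' v0) <= n ->
  exists2 p, @is_walk (Cay S) h h' p & size p <= n.+1.
Proof.
elim: n z h => [|n IH] z h hz zh'.
  have ? : z = a h' v0 by apply: (gdist_eq0 Gconn); lia.
  by subst z; have [|p wp sp] := @cayley_edge h h'; [lia|exists p; lia].
have [z0|z0] := posnP (gdist z (a h' v0)).
  have ? : z = a h' v0 by apply: (gdist_eq0 Gconn).
  by subst z; have [|p wp sp] := @cayley_edge h h'; [lia|exists p; lia].
have [z1 [zz1 z1h']] := gdist_step Gconn z0.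
have [g gz1] := cob z1.
have [|q wq sq] := IH z1 g gz1; first lia.
have [|p wp sp] := @cayley_edge h g.
  have := gdist_tri Gconn (a h v0) z (a g v0); have := gdist_tri Gconn z z1 (a g v0).
  by rewrite (gdist_sym Gconn z1); lia.
by exists (p ++ q); [exact: is_walk_cat wp wq|rewrite size_cat; lia].
Qed.

Lemma cayley_dist_le h h' : @gdist (Cay S) h h' <= (gdist (a h v0) (a h' v0)).+1.
Proof.
have [|p wp sp] := @cayley_walk _ (a h v0) h h' _ (leqnn _); first by rewrite gdist0.
exact: leq_trans (gdist_le_walk wp) sp.
Qed.

Lemma cayley_dist_ge h h' :
  gdist (a h v0) (a h' v0) <= c0.*2.+1 * @gdist (Cay S) h h'.
Proof.
have [p wp <-] : exists2 p, @is_walk (Cay S) h h' p & size p = @gdist (Cay S) h h'.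
  apply: gdist_walk; have [|p wp sp] := @cayley_walk _ (a h v0) h h' _ (leqnn _).
    by rewrite gdist0.
  by exists p.
elim: p h wp => [|x p IH] h.
  by rewrite /is_walk /= => /eqP ->; rewrite gdist0.
rewrite /is_walk /= -andbA => /and3P [/andP [_ hx] px lx].
have := IH x; rewrite /is_walk px lx => /(_ erefl).
move: hx; rewrite mem_letters (gdist_sym Gconn) gdist_mul (gdist_sym Gconn).
move=> e1 e2; apply: leq_trans (gdist_tri Gconn _ (a x v0) _) _.
by rewrite mulnS leq_add.
Qed.

(* The word [rev r] follows, up to the constant [c0], a geodesic from [v0] to
   [z], which itself stays close to sets that end with [T] and are determined
   by [T]. *)
Fixpoint tracks (r : seq gT) (z : G) (T : set G) : Prop :=
  if r is s :: r' then
    [/\ gdist (a (word_val (rev r)) v0) z <= c0, (exists t, T t),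
        (forall t, T t -> gdist z t <= 4) &
        if r' is [::] then z = v0 else
          exists z1 T1, [/\ tracks r' z1 T1, gdist v0 z = (gdist v0 z1).+1,
            gdist z1 z = 1 & T1 = step (@gdist G) v0 (gdist v0 z1) T]]
  else False.

Lemma tracks_near r z T : tracks r z T ->
  [/\ gdist (a (word_val (rev r)) v0) z <= c0, (exists t, T t) &
      forall t, T t -> gdist z t <= 4].
Proof. by case: r => [//|s r] []. Qed.

(** The first letter only reaches the vicinity of [v0], so level [j] corresponds to [j + 1]
    letters. *)
Lemma tracks_traj r z T : tracks r z T -> size r = (gdist v0 z).+1 /\
  forall j, j <= gdist v0 z -> exists y,
    traj (@gdist G) v0 (gdist v0 z) T j y /\
    gdist (a (word_val (take j.+1 (rev r))) v0) y <= c0 + 4.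
Proof.
elim: r z T => [//|s r IH] z T rzT; have [nz [t Tt] zT] := tracks_near rzT.
have near_t : gdist (a (word_val (rev (s :: r))) v0) t <= c0 + 4.
  by have := zT t Tt; have := gdist_tri Gconn (a (word_val (rev (s :: r))) v0) z t; lia.
case: r IH rzT near_t nz => [|s1 r] IH rzT near_t nz.
  case: rzT => _ _ _ e; rewrite e gdist0 //=; split=> // j _.
  by exists t; case: j => [|j].
case: rzT => _ _ _ [z1 [T1 [r1 vz z1z eT1]]]; have [sz hj] := IH _ _ r1.
split; first by rewrite vz -sz.
move=> j jz; have [->|jz'] := eqVneq j (gdist v0 z).
  exists t; split; first by rewrite traj_top.
  by rewrite take_oversize // size_rev /= -[(size r).+1]/(size (s1 :: r)) sz vz.
have jz1 : j <= gdist v0 z1 by lia.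
have [y [Ty ny]] := hj j jz1; exists y; rewrite vz /= jz1 -eT1; split=> //.
by rewrite rev_cons -cats1 takel_cat // size_rev sz.
Qed.

(** * Transfer between words with equal data *)

Section Translate.
Variables (r r' : seq gT) (s : gT).
Let h := word_val (rev r).
Let h' := word_val (rev r').
Let phi x := a h' (a h^-1%g x).
Let psi x := a h (a h'^-1%g x).

(** Here [phi] moves the frame of [r] to that of [r']. Radius 7 suffices since a vertex within 2 of
    [T] is within 2 + 4 + 1 of [z1]; [ball_extension] carries the trace from [z1] to [z]. *)
Lemma tracks_translate z1 T1 z T T1' : r != [::] -> r' != [::] ->
  gdist v0 z = (gdist v0 z1).+1 -> gdist z1 z = 1 ->
  T1 = step (@gdist G) v0 (gdist v0 z1) T ->
  gdist (a (h * s)%g v0) z <= c0 -> (exists t, T t) -> (forall t, T t -> gdist z t <= 4) ->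
  tracks r' (phi z1) T1' -> (forall x, T1' (phi x) <-> T1 x) ->
  (forall x, gdist z1 x <= 7 ->
     (gdist v0 (phi x) <= gdist v0 (phi z1)) = (gdist v0 x <= gdist v0 z1)) ->
  tracks (s :: r') (phi z) [set y | T (psi y)] /\
  forall x, gdist z x <= 7 ->
     (gdist v0 (phi x) <= gdist v0 (phi z)) = (gdist v0 x <= gdist v0 z).
Proof.
move=> rn r'n vz z1z eT1 nz [t0 Tt0] zT tr' T1e TR.
have phid x y : gdist (phi x) (phi y) = gdist x y by rewrite /phi !gd.
have phiK x : psi (phi x) = x by rewrite /phi /psi actK actKV.
have psiK x : phi (psi x) = x by rewrite /phi /psi actK actKV.
have z71 : gdist z1 z <= 7 by rewrite z1z.
(* Since [z] is outside the trace at [z1], its image is outside the translated one. *)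
have vz' : gdist v0 (phi z) = (gdist v0 (phi z1)).+1.
  have := TR z z71; rewrite vz ltnn => /negbT; rewrite -ltnNge.
  by have := gdist_tri Gconn v0 (phi z1) (phi z); rewrite phid z1z; lia.
split; last first.
  move=> x zx; apply/idP/idP => hx.
    have [|||||x1 [x1x vx1 z1x1]] := @ball_extension _ _ cb 7 v0 (phi z1) (phi z) (phi x);
      rewrite ?phid //.
    move: x1x z1x1 vx1; rewrite -(psiK x1) !phid => x1x z1x1 vx1.
    rewrite TR // in vx1.
    by have := gdist_tri Gconn v0 (psi x1) x; lia.
  have [|||||x1 [x1x vx1 z1x1]] := @ball_extension _ _ cb 7 v0 z1 z x => //.
  rewrite -TR // in vx1.
  by have := gdist_tri Gconn v0 (phi x1) (phi x); rewrite phid; lia.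
split.
- rewrite rev_cons word_val_rcons -/h'.
  have -> : a (h' * s)%g v0 = phi (a (h * s)%g v0) by rewrite /phi !actM actK.
  by rewrite phid.
- by exists (phi t0); rewrite /= phiK.
- by move=> t /= /zT; rewrite -{2}(psiK t) phid.
case: r' r'n tr' phid phiK psiK => [//|s' r2] _ tr' phid phiK psiK.
exists (phi z1), T1'; split=> //; first by rewrite phid.
apply/seteqP; split=> y; rewrite -(psiK y).
  rewrite T1e eT1 => -[vy hy]; split.
    rewrite TR //; have := hy _ Tt0; have := zT _ Tt0.
    by have := gdist_tri Gconn z1 z (psi y); have := gdist_tri Gconn z t0 (psi y); lia.
  by move=> t /= Tt; rewrite -(psiK t) phid; apply: hy.
move=> [vy hy].
have hy' t : T t -> gdist t (psi y) <= 2.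
  by move=> Tt; rewrite -phid; apply: hy; rewrite /= phiK.
rewrite T1e eT1; split=> //; rewrite -TR //.
have := hy' _ Tt0; have := zT _ Tt0.
by have := gdist_tri Gconn z1 z (psi y); have := gdist_tri Gconn z t0 (psi y); lia.
Qed.

End Translate.

(** * Finite states and acceptance *)

Variable ball : seq G.
Hypothesis mem_ball : forall x, (x \in ball) = (gdist v0 x <= c0 + 7).
Let B : finType := seq_sub ball.

(* [c] records the position, the current set of the thread and the trace of the
   ball of [v0], all read in the frame of the group element spelled by [rev r]. *)
Definition encodes (r : seq gT) (c : B * {set B} * {set B}) : Prop :=
  let h := word_val (rev r) in
  exists z T, [/\ tracks r z T, a h (val c.1.1) = z,
    forall b : B, b \in c.1.2 <-> T (a h (val b)) &
    forall b : B, b \in c.2 <->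
      gdist v0 (a h (val b)) <= gdist v0 z /\ gdist z (a h (val b)) <= 7].

Lemma translate_in_ball r z T x : tracks r z T -> gdist z x <= 7 ->
  exists b : B, a (word_val (rev r)) (val b) = x.
Proof.
move=> /tracks_near [nz _ _] zx; set h := word_val _ in nz *.
have xb : a h^-1%g x \in ball.
  rewrite mem_ball -(gd h) actKV; have := gdist_tri Gconn (a h v0) z x; lia.
by exists (SeqSub xb); rewrite /= actKV.
Qed.

(** A code of [s :: r] has a predecessor coded by [r]. Read through [r'], that code describes the
    translates by [phi], which [tracks_translate] extends by [s]. *)
Lemma encodes_step r r' s c : r != [::] -> r' != [::] ->
  (forall c, encodes r c -> encodes r' c) -> encodes (s :: r) c -> encodes (s :: r') c.
Proof.
move=> rn r'n sub [z [T [rz ez eT eW]]].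
set h := word_val (rev r) in sub; set h' := word_val (rev r') in sub.
pose phi x := a h' (a h^-1%g x); pose psi x := a h (a h'^-1%g x).
have valk : word_val (rev (s :: r)) = (h * s)%g by rewrite rev_cons word_val_rcons.
have valk' : word_val (rev (s :: r')) = (h' * s)%g by rewrite rev_cons word_val_rcons.
have [nz Tn zT] := tracks_near rz.
have [z1 [T1 [r1 vz z1z eT1]]] : exists z1 T1, [/\ tracks r z1 T1,
    gdist v0 z = (gdist v0 z1).+1, gdist z1 z = 1
    & T1 = step (@gdist G) v0 (gdist v0 z1) T].
  by case: (r) rn rz => [//|s1 r1] _ [].
have [b1 eb1] := @translate_in_ball r z1 T1 z1 r1 ltac:(by rewrite gdist0).
pose c1 : B * {set B} * {set B} := (b1, [set b | `[< T1 (a h (val b)) >]]%SET,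
  [set b | (gdist v0 (a h (val b)) <= gdist v0 z1) && (gdist z1 (a h (val b)) <= 7)]%SET).
have /sub [z1' [T1' [r1' ez1' eT1' eW1']]] : encodes r c1.
  exists z1, T1; split=> //= b; rewrite inE.
    by split=> [/asboolP|] //; move/asboolP.
  by split=> /andP.
have ez1'' : z1' = phi z1 by rewrite -ez1' -eb1 /phi actK.
rewrite {z1' ez1'}ez1'' in r1' eW1'.
have phib b : phi (a h b) = a h' b by rewrite /phi actK.
have [_ _ zT1'] := tracks_near r1'; have [_ _ zT1] := tracks_near r1.
have phid x y : gdist (phi x) (phi y) = gdist x y by rewrite /phi !gd.
have TR x : gdist z1 x <= 7 ->
    (gdist v0 (phi x) <= gdist v0 (phi z1)) = (gdist v0 x <= gdist v0 z1).
  move=> z1x; have [b eb] := translate_in_ball r1 z1x.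
  have {}eb : a h (val b) = x := eb.
  have := eW1' b; rewrite inE -/h' eb z1x andbT -phib eb phid z1x => e.
  by apply/idP/idP => hx; [apply/e|case/e: hx].
(* The code only sees radius 7, but both sets lie within 4 of their positions. *)
have T1e x : T1' (phi x) <-> T1 x.
  have main : gdist z1 x <= 7 -> T1' (phi x) <-> T1 x.
    move=> z1x; have [b eb] := translate_in_ball r1 z1x.
    have {}eb : a h (val b) = x := eb.
    have := eT1' b; rewrite inE -/h' eb -phib eb => <-.
    by split=> [/asboolP|] //; move/asboolP.
  split=> [hx|hx]; apply/main => //.
    by have := zT1' _ hx; rewrite phid; lia.
  by have := zT1 _ hx; lia.
rewrite valk in nz.
have [tr TR'] := @tracks_translate r r' s z1 T1 z T T1' rn r'n vz z1z eT1 nz Tn zT r1' T1e TR.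
exists (phi z), [set y | T (psi y)].
have phik b : phi (a (h * s)%g b) = a (h' * s)%g b by rewrite /phi !actM actK.
have phiK x : psi (phi x) = x by rewrite /phi /psi actK actKV.
rewrite valk in ez eT eW; rewrite valk'; split=> //.
- by rewrite -phik ez.
- by move=> b; rewrite eT /= -phik phiK.
- move=> b; rewrite eW -phik phid.
  by split=> -[h1 h2]; split=> //; move: h1; rewrite TR'.
Qed.

(** Collecting all codes makes the guesses deterministic. Emptiness is recorded because [tracks]
    treats the first letter separately. *)
Definition state (w : seq gT) : bool * {set B * {set B} * {set B}} :=
  (nilp w, [set c | `[< encodes (rev w) c >]]%SET).

Lemma state_rcons w w' s : state w = state w' -> state (rcons w s) = state (rcons w' s).
Proof.
move=> [en /setP e].
case: w en e => [|x w]; case: w' => [|x' w'] // _ e.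
have n1 : rev (x :: w) != [::] by rewrite -size_eq0 size_rev.
have n2 : rev (x' :: w') != [::] by rewrite -size_eq0 size_rev.
congr (_, _); apply/setP => c; rewrite !inE !rev_rcons.
apply/asboolP/asboolP; apply: encodes_step => // c' hc'.
  by have := e c'; rewrite !inE (asboolT hc') => /esym/asboolP.
by have := e c'; rewrite !inE (asboolT hc') => /asboolP.
Qed.

(** In the frame of the word the last set must be the singleton of the end point, so the guessed
    sets form its thread. *)
Definition accepting (q : bool * {set B * {set B} * {set B}}) : bool :=
  [exists c, [&& c \in q.2, val c.1.1 == v0 & c.1.2 == [set b | val b == v0]%SET]].

Lemma acceptingP w : reflect
  (tracks (rev w) (a (word_val w) v0) [set a (word_val w) v0]) (accepting (state w)).
Proof.
apply: (iffP existsP) => [[c /and3P [cq /eqP c0E /eqP c1E]]|tr].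
  move: cq; rewrite inE => /asboolP [z [T [tr ez eT _]]].
  move: ez eT; rewrite revK c0E => ez eT; subst z.
  rewrite (_ : [set _] = T) //; apply/seteqP; split.
    have vb : v0 \in ball by rewrite mem_ball gdist0.
    by move=> _ ->; rewrite -[v0]/(val (SeqSub vb)) -eT c1E inE.
  move=> t Tt; have [_ _ zT] := tracks_near tr.
  have [|b] := @translate_in_ball _ _ _ t tr; first by have := zT t Tt; lia.
  rewrite revK => eb; have : b \in c.1.2 by apply/eT; rewrite eb.
  by rewrite c1E inE => /eqP e; rewrite -eb e.
have vb : v0 \in ball by rewrite mem_ball gdist0.
pose h := word_val w.
exists (SeqSub vb, [set b | val b == v0]%SET, [set b : B | (gdist v0 (a h (val b)) <= gdist v0 (a h v0)) &&
  (gdist (a h v0) (a h (val b)) <= 7)]%SET).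
rewrite /= !eqxx inE !andbT; apply/asboolP.
exists (a h v0), [set a h v0]; rewrite revK -/h; split=> //= b; rewrite inE.
  by split=> [/eqP -> //|/(can_inj (actK a h)) ->].
by split=> /andP.
Qed.

Definition tracking_language : set (seq gT) :=
  [set w | all [in letters S] w /\ accepting (state w)].

(** * The language and its fellow travellers *)

(** The word visits orbit points within [c0] of the geodesic from [thread_along_geodesic], with [g]
    itself imposed as the last group element. *)
Lemma tracking_word g : exists2 w, tracking_language w & word_val w = g.
Proof.
have [z [zx hz]] := thread_along_geodesic cb locfin v0 (a g v0).
set k := gdist v0 (a g v0) in zx hz.
have /choice [h0 nh0] := fun j => cob (z j).
pose h j := if j == k then g else h0 j.
have nh j : gdist (a (h j) v0) (z j) <= c0.
  by rewrite /h; case: eqP => [->|_] //; rewrite zx gdist0.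
pose w := fix w j := if j is j'.+1 then ((h j')^-1 * h j)%g :: w j' else [:: h 0].
have vw j : word_val (rev (w j)) = h j.
  case: j => [|j]; first by rewrite /word_val /= big_seq1.
  elim: j => [|j IH]; rewrite [w _]/= rev_cons word_val_rcons.
    by rewrite /word_val /= big_seq1 mulVKg.
  by rewrite -[_ :: w j]/(w j.+1) IH mulVKg.
have nw j : gdist (a (word_val (rev (w j))) v0) (z j) <= c0 by rewrite vw.
have tw j : j <= k -> tracks (w j) (z j) (thread v0 (a g v0) j).
  elim: j => [|j IH] jk; have [vz zz zT] := hz _ jk.
    split; [exact: (nw 0)|exact: thread_nonempty|exact: zT|].
    by apply/esym/(gdist_eq0 Gconn).
  have step_ok : exists z1 T1, [/\ tracks (w j) z1 T1, gdist v0 (z j.+1) = (gdist v0 z1).+1,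
      gdist z1 (z j.+1) = 1
      & T1 = step (@gdist G) v0 (gdist v0 z1) (thread v0 (a g v0) j.+1)].
    have [vzj zzj _] := hz j (ltnW jk).
    exists (z j), (thread v0 (a g v0) j); split; [exact/IH/ltnW|lia|exact: zzj|].
    by rewrite vzj /thread thread_step.
  split; [exact: (nw j.+1)|exact: thread_nonempty|exact: zT|].
  by case: (j) step_ok.
exists (rev (w k)); last by rewrite vw /h eqxx.
split.
  rewrite all_rev; apply/allP => s sw.
  have : forall j, j <= k -> s \in w j -> s \in letters S.
    elim=> [|j IH] jk.
      rewrite inE => /eqP ->; rewrite mem_letters; have [vz _ _] := hz 0 (leq0n k).
      have e : v0 = z 0 by apply: (gdist_eq0 Gconn).
      by have := nh 0; rewrite -e (gdist_sym Gconn); lia.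
    rewrite inE => /orP [/eqP ->|]; last exact/IH/ltnW.
    rewrite mem_letters (gdist_sym Gconn) gdist_mul.
    have [_ zzj _] := hz j (ltnW jk); have := zzj jk.
    have := nh j; have := nh j.+1.
    have := gdist_tri Gconn (a (h j.+1) v0) (z j.+1) (a (h j) v0).
    have := gdist_tri Gconn (z j.+1) (z j) (a (h j) v0).
    by rewrite (gdist_sym Gconn (z j.+1) (z j)) (gdist_sym Gconn (z j) (a _ _)); lia.
  by move=> /(_ k (leqnn k) sw).
apply/acceptingP; rewrite revK vw.
have := tw k (leqnn k); rewrite zx /thread thread_top //.
by rewrite /h eqxx.
Qed.

Lemma tracking_near_thread w i : tracking_language w ->
  exists y, thread v0 (a (word_val w) v0) i.-1 y /\
    gdist (a (word_val (take i w)) v0) y <= c0 + 4.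
Proof.
move=> [_ /acceptingP tr]; have [sz hj] := tracks_traj tr.
rewrite revK size_rev in sz hj.
case: i => [|i] /=.
  (* The empty prefix is compared with level 0, like the prefix of length 1. *)
  have [t [Tt vt _]] := @thread_point _ _ cb locfin v0 (a (word_val w) v0) 0 (leq0n _).
  exists t; split=> //; rewrite take0 /word_val big_nil act1.
  by rewrite vt.
case: (leqP i (gdist v0 (a (word_val w) v0))) => hi; first exact: hj.
exists (a (word_val w) v0); rewrite /thread thread_top; last exact: ltnW.
by rewrite take_oversize ?gdist0 // sz; lia.
Qed.

Lemma tracking_fellow_traveler : fellow_traveler2 S tracking_language.
Proof.
(* Each pair of ends contributes [248 * (2 c0 + 1)]. The additive term collects 8 from
   [thread_fellow], 1 from [cayley_dist_le] and [c0 + 4] for each word. *)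
exists (2 * 248 * c0.*2.+1).+1, (9 + 2 * (c0 + 4)); split=> // g1 g2 w1 w2 L1 L2 i.
rewrite /word_path !take_size.
set D1 := @gdist (Cay S) g1 g2; set D2 := @gdist (Cay S) (g1 * word_val w1)%g _.
have [y1 [T1 n1]] := tracking_near_thread i L1.
have [y2 [T2 n2]] := tracking_near_thread i L2.
have tr g x y : thread v0 x i.-1 y -> thread (a g v0) (a g x) i.-1 (a g y).
  move=> Ty; rewrite /thread.
  apply/(@thread_isometry _ _ cb (a g) v0 x i.-1 y); [exact: gd| |exact: Ty].
  by move=> b; exists (a g^-1%g b); rewrite actKV.
have := thread_fellow cb locfin (tr g1 _ _ T1) (tr g2 _ _ T2).
rewrite -!actM => fel.
have := cayley_dist_ge g1 g2; rewrite -/D1 => d1.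
have := cayley_dist_ge (g1 * word_val w1)%g (g2 * word_val w2)%g; rewrite -/D2 => d2.
apply: leq_trans (cayley_dist_le _ _) _; rewrite !actM.
rewrite -(gd g1) in n1; rewrite -(gd g2) in n2.
set p1 := a g1 (a (word_val (take i w1)) v0) in n1 *.
set p2 := a g2 (a (word_val (take i w2)) v0) in n2 *.
have t1 := gdist_tri Gconn p1 (a g1 y1) p2.
have t2 := gdist_tri Gconn (a g1 y1) (a g2 y2) p2.
rewrite (gdist_sym Gconn p2) in n2.
have m1 : c0.*2.+1 * D1 <= c0.*2.+1 * maxn D1 D2 by rewrite leq_mul2l leq_maxl orbT.
have m2 : c0.*2.+1 * D2 <= c0.*2.+1 * maxn D1 D2 by rewrite leq_mul2l leq_maxr orbT.
move: d1 d2 m1 m2; rewrite mulSn -!mulnA.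
set M := c0.*2.+1 * maxn D1 D2; lia.
Qed.

Lemma tracking_generates : generates S.
Proof. by move=> g; have [w [Lw _] e] := tracking_word g; exists w. Qed.

Lemma tracking_biautomatic : biautomatic gT.
Proof.
exists S, tracking_language; split.
- exact: tracking_generates.
- exact: (regular_of_congruence _ _ state_rcons).
- exact: tracking_word.
- exact: tracking_fellow_traveler.
Qed.

End Biautomatic.

Theorem theorem6p10 (G : graph) (gT : groupType) (a : graph_action gT G)
    (Gconn : connected_graph G) (Gcb : convex_balls G)
    (ageom : geometric_action a) :
  biautomatic gT.
Proof.
have [[v0] _] := Gconn.
have [c0 cob] := cobounded Gconn ageom v0.
have [S memS] := finite_displacement Gconn ageom v0 c0.*2.+1.
have /finite_seqP [ball eball] := finite_gball Gconn ageom v0 (c0 + 7).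
apply: (tracking_biautomatic Gconn Gcb ageom cob memS (ball := ball)) => x.
have := congr1 (fun A => A x) eball; rewrite /gball /= => e.
by apply/idP/idP; rewrite e.
Qed.
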